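(* Let $X_1,X_2,\ldots$ be a Markov chain with values in $\mathcal{S}$ satisfying the Minorization condition with $m=1$ and admitting a (unique) stationary distribution $\pi$, realized as the split chain described in the context, and assume $\|T_1\|_{\psi_1},\|T_2\|_{\psi_1}\le\tau$. Let $f\colon\mathcal{S}^n\to\mathbb{R}$ be measurable, invariant under permutations of its arguments ($f(x_1,\ldots,x_n)=f(x_{\sigma(1)},\ldots,x_{\sigma(n)})$ for every permutation $\sigma$ of $\{1,\ldots,n\}$), and $L$-Lipschitz with respect to the Hamming distance: $|f(x_1,\ldots,x_n)-f(y_1,\ldots,y_n)|\le L\,\#\{i\colon x_i\ne y_i\}$. Then for all $t\ge0$, $$\mathbb{P}\big(|f(X_1,\ldots,X_n)-\mathbb{E} f(X_1,\ldots,X_n)|\ge t\big)\le2\exp\Big(-\frac1K\frac{t^2}{nL^2\tau^2}\Big),$$ where $K$ is a universal constant.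
   Context: Markov chain $X_1,X_2,\ldots$ on $(\mathcal{S},\mathcal{B})$ with kernel $P$ and initial law $\xi$. Minorization condition with $m=1$: there exist $\delta>0$, $C\in\mathcal{B}$ and a probability measure $\nu$ with $P(x,A)\ge\delta\nu(A)$ for $x\in C$, $A\in\mathcal{B}$, and for every $x$ some $n$ with $P^n(x,C)>0$. Split chain: $(X_n,R_n)\in\mathcal{S}\times\{0,1\}$ with $(X_n)$ Markov with kernel $P$ and initial law $\xi$; $T_1=\inf\{n>0\colon R_n=1\}$, $T_{i+1}=\inf\{n>0\colon R_{T_1+\cdots+T_i+n}=1\}$; the $T_i$ are independent, $T_2,T_3,\ldots$ i.i.d., and the blocks $(X_1,\ldots,X_{T_1})$, $(X_{T_1+\cdots+T_{i}+1},\ldots,X_{T_1+\cdots+T_{i+1}})$, $i\ge1$, are independent. $\|\cdot\|_{\psi_1}$ is the Orlicz norm with $\psi_1(x)=e^x-1$. *)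

(* Defs.v *)
From HB Require Import structures.
From mathcomp Require Import all_boot all_order all_algebra all_fingroup.
From mathcomp Require Import all_classical all_reals all_analysis.
Set Implicit Arguments. Unset Strict Implicit. Unset Printing Implicit Defensive.
Import Order.TTheory GRing.Theory Num.Theory.
Import numFieldNormedType.Exports.
Local Open Scope classical_set_scope.
Local Open Scope ring_scope.
Local Open Scope ereal_scope.

Section MarkovDefs.
Context {R : realType} {d : measure_display} {S : measurableType d}.

Fixpoint kernel_iter (P : R.-pker S ~> S) (n : nat) (x : S) (A : set S) : \bar R :=
  match n with
  | 0%N => (\1_A x)%:E
  | n'.+1 => \int[P x]_y kernel_iter P n' y A
  end.

Definition minorization (P : R.-pker S ~> S) (delta : R) (C : set S)
  (nu : probability S R) : Prop :=
  (0 < delta)%R /\ measurable C /\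
  (forall x A, C x -> measurable A -> (delta%:E * nu A <= P x A)) /\
  (forall x, exists n : nat, 0 < kernel_iter P n.+1 x C).

Definition stationary (P : R.-pker S ~> S) (pi : probability S R) : Prop :=
  forall A, measurable A -> pi A = \int[pi]_x P x A.

(* Split-chain finite-dimensional weights.  Given the current state x = X_i,
   [split_tail P delta C nu r A k i x] is the conditional probability that
   R_i = r i, X_{i+1} \in A (i+1), ..., R_{i+k-1} = r (i+k-1),
   X_{i+k} \in A (i+k).  One step from x: (R_i = 1, X_{i+1} in dy) has
   weight delta 1_C(x) nu(dy), (R_i = 0, X_{i+1} in dy) has weight
   P(x,dy) - delta 1_C(x) nu(dy)  (Nummelin splitting). *)
Fixpoint split_tail (P : R.-pker S ~> S) (delta : R) (C : set S)
  (nu : probability S R) (r : nat -> bool) (A : nat -> set S)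
  (k i : nat) (x : S) : \bar R :=
  match k with
  | 0%N => 1
  | k'.+1 =>
    let g := split_tail P delta C nu r A k' i.+1 in
    let w := (delta * \1_C x)%R%:E in
    if r i then w * \int[nu]_(y in A i.+1) g y
    else \int[P x]_(y in A i.+1) g y - w * \int[nu]_(y in A i.+1) g y
  end.

(* (X_n, R_n)_{n >= 1} (index 0 unused) is the split chain of the Markov chain
   with kernel P, initial law xi, for the minorization (delta, C, nu):
   the law of (X_1, R_1, X_2, ..., R_k, X_{k+1}) is prescribed for every k. *)
Definition is_split_chain {dO : measure_display} {O : measurableType dO}
  (Pr : probability O R) (P : R.-pker S ~> S) (xi : probability S R)
  (delta : R) (C : set S) (nu : probability S R)
  (X : nat -> O -> S) (Rg : nat -> O -> bool) : Prop :=
  forall (k : nat) (r : nat -> bool) (A : nat -> set S),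
    (forall i, measurable (A i)) ->
    Pr [set w | A 1%N (X 1%N w) /\
        (forall i, (1 <= i <= k)%N -> Rg i w = r i /\ A i.+1 (X i.+1 w))]
    = \int[xi]_(x in A 1%N) split_tail P delta C nu r A k 1%N x.

(* regeneration times: T_1 = inf{n > 0 : R_n = 1},
   T_2 = inf{n > 0 : R_{T_1 + n} = 1}; inf of the empty set is +oo *)
Definition regen_T1 {O : Type} (Rg : nat -> O -> bool) (w : O) : \bar R :=
  ereal_inf [set (n%:R)%:E | n in [set n : nat | (0 < n)%N /\ Rg n w]].

Definition regen_T2 {O : Type} (Rg : nat -> O -> bool) (w : O) : \bar R :=
  ereal_inf [set (n%:R)%:E | n in [set n : nat | (0 < n)%N /\
     exists m : nat, [/\ (0 < m)%N, Rg m w,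
                        (forall j, (0 < j < m)%N -> ~~ Rg j w)
                      & Rg (m + n)%N w]]].
End MarkovDefs.

(* Orlicz psi_1 norm, psi_1(x) = e^x - 1:
   ||Y||_psi1 = inf { c > 0 : E psi_1(|Y|/c) <= 1 } (inf of empty = +oo) *)
Definition psi1_norm {R : realType} {dO : measure_display} {O : measurableType dO}
  (Pr : probability O R) (Y : O -> \bar R) : \bar R :=
  ereal_inf [set c%:E | c in [set c : R | (0 < c)%R /\
     \int[Pr]_w (expeR (`|Y w| * (c^-1)%:E) - 1) <= 1]].

Definition hamming {T : eqType} {n : nat} (x y : n.-tuple T) : nat :=
  #|[set i : 'I_n | tnth x i != tnth y i]|.

(* Main.v *)
(** Write [h_j(x)] for the mean of [f] when its first [j] arguments are [x] and the
    rest is a chain started from [nu], and stop the chain at its first regeneration,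
    capped at the remaining length.  By the regeneration property the mean of [f] is
    unchanged when the future after that time is integrated out, and since [f] is
    symmetric, freezing a block of length [k] moves [h] by at most [L k].  A block has
    an exponential moment at scale [c <= 2 tau], so
    [e^u <= 1 + u + u^2 e^|u|] gives each block a Laplace transform bounded by
    [exp (lam * mean + 24 (lam L c)^2)] for [lam L <= 1 / (2 c)].  Backward induction on
    [j] (there are at most [n] blocks) and Chernoff's bound conclude: [|f - E f| <= n L]
    makes the constraint on [lam] harmless.  The chain started from [nu] is realised on
    the given space, as the chain shifted by [k] under [Pr] conditioned on [T_1 = k], for
    a [k] under which the second block keeps its exponential moment. *)

Require Import Defs.
From HB Require Import structures.
From mathcomp Require Import all_boot all_order all_algebra all_fingroup.
From mathcomp Require Import all_classical all_reals all_analysis.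
From mathcomp Require Import measurable_realfun zify ring lra.
Set Implicit Arguments. Unset Strict Implicit. Unset Printing Implicit Defensive.
Import Order.TTheory GRing.Theory Num.Theory.
Import numFieldNormedType.Exports.
Local Open Scope classical_set_scope.
Local Open Scope ring_scope.

(** * Paths, splicing and first hitting times *)

(** The difficulty is the random length of a block. A block of length [k] pushes everything after it
    back by [k] places, so every later argument of [f] may change; symmetry realigns the two paths
    and leaves at most [k] disagreements. The induction runs over the number of frozen arguments,
    with a bound uniform in their values, because the number of blocks is random: each block freezes
    at least one more argument and is paid for by one unit of the budget [n - j]. The first block
    has its own law and all later ones share another, so two chains are carried along: the given
    one, and a fresh one that takes over after a regeneration of either. The Laplace estimate uses
    the split chain only through this exchange of futures, [regenerates], and through the
    exponential moments of the blocks. Capping the blocks keeps every function of their length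
    bounded, so an infinite regeneration time needs no separate treatment. *)

Definition splice {S : Type} (j : nat) (x y : nat -> S) (i : nat) : S :=
  if (i < j)%N then x i else y (i - j)%N.

Definition prefix_tuple {S : Type} (n : nat) (x : nat -> S) : n.-tuple S :=
  [tuple x i | i < n].

Lemma spliceA {S : Type} (j k : nat) (x y z : nat -> S) :
  splice j x (splice k y z) = splice (j + k) (splice j x y) z.
Proof.
apply/funext => i; rewrite /splice.
case: (ltnP i j) => ij; first by rewrite (leq_trans ij (leq_addr _ _)).
by rewrite ltn_subLR// subnDA.
Qed.

Lemma eq_prefix_tuple {S : Type} (n : nat) (x y : nat -> S) :
  (forall i, (i < n)%N -> x i = y i) -> prefix_tuple n x = prefix_tuple n y.
Proof. by move=> xy; apply: eq_from_tnth => i; rewrite !tnth_mktuple xy. Qed.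

Lemma prefix_tuple_splice {S : Type} (n : nat) (x y : nat -> S) :
  prefix_tuple n (splice n x y) = prefix_tuple n x.
Proof. by apply: eq_prefix_tuple => i ni; rewrite /splice ni. Qed.

(* The permutation moves the last [k] entries to positions [j, ..., j + k - 1]. *)
Lemma symmetric_lipschitz_splice {R : realType} {S : eqType} (n : nat)
    (f : n.-tuple S -> R) (L : R) (j k : nat) (x y z : nat -> S) :
  0 <= L ->
  (forall (s : 'S_n) (u : n.-tuple S), f [tuple tnth u (s i) | i < n] = f u) ->
  (forall u v : n.-tuple S, `|f u - f v| <= L * (hamming u v)%:R) ->
  (j + k <= n)%N ->
  `|f (prefix_tuple n (splice (j + k) (splice j x y) z)) -
    f (prefix_tuple n (splice j x z))| <= L * k%:R.
Proof.
move=> L0 fsym fL jkn.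
pose g (i : nat) : nat := if (i < j)%N then i else
  if (i < j + k)%N then (i + n - (j + k))%N else (i - k)%N.
have gn (i : 'I_n) : (g i < n)%N by rewrite /g; move: (ltn_ord i); repeat case: ifP; lia.
have ginj : injective (fun i => Ordinal (gn i)).
  move=> i1 i2 [] e; apply: val_inj => /=; move: e (ltn_ord i1) (ltn_ord i2).
  by rewrite /g; repeat case: ifP; lia.
rewrite -[f (prefix_tuple n (splice j x z))](fsym (perm ginj)).
apply: le_trans (fL _ _) _; rewrite ler_wpM2l// ler_nat.
(* Away from the block the realigned paths agree, so disagreements lie among the [k] positions of
   [A]. *)
pose A := [set i : 'I_n | (j <= i < j + k)%N]%SET.
apply: (@leq_trans #|A|).
  apply/subset_leq_card/fintype.subsetP => i; rewrite !inE; apply: contraNT => iA.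
  apply/eqP; rewrite !tnth_mktuple permE /= /splice /g.
  move: iA; rewrite negb_and -leqNgt -ltnNge.
  case: (ltnP i j) => ij /= ijk; first by rewrite (leq_trans ij (leq_addr _ _)) ij.
  have -> : (i < j + k)%N = false by lia.
  have -> : (i - k < j)%N = false by lia.
  by congr z; lia.
have inA (i : 'I_k) : (j + i < n)%N by move: (ltn_ord i); lia.
rewrite -[leqRHS]card_ord -(card_imset predT (f := fun i : 'I_k => Ordinal (inA i))); last first.
  by move=> a b [] ab; apply: val_inj; apply/eqP; rewrite -(eqn_add2l j); apply/eqP.
apply/subset_leq_card/fintype.subsetP => i; rewrite inE => /andP[ji ijk].
have ik : (i - j < k)%N by lia.
by apply/imsetP; exists (Ordinal ik) => //; apply: val_inj => /=; lia.
Qed.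

(** A length rather than an index: a first success at index [k] gives [k + 1], which matches
    regeneration times counted from 1; [m] is the cap when no success comes in time. *)
Fixpoint stopped_time (b : nat -> bool) (m : nat) : nat :=
  match m with
  | 0%N => 0%N
  | m'.+1 => if b 0%N then 1%N else (stopped_time (fun i => b i.+1) m').+1
  end.

Definition first_hit (b : nat -> bool) (k : nat) : bool :=
  b k && [forall i : 'I_k, ~~ b i].

Lemma first_hitP (b : nat -> bool) (k : nat) :
  reflect (b k /\ forall i, (i < k)%N -> ~~ b i) (first_hit b k).
Proof.
apply: (iffP andP) => -[bk h]; split => //.
  by move=> i ik; have /forallP/(_ (Ordinal ik)) := h.
by apply/forallP => i; apply: h.
Qed.

Lemma first_hitS (b : nat -> bool) (k : nat) :
  first_hit b k.+1 = ~~ b 0%N && first_hit (fun i => b i.+1) k.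
Proof.
apply/first_hitP/andP => [[bk h]|[b0 /first_hitP[bk h]]].
  by split; [exact: h|apply/first_hitP; split => // i ik; exact: h].
by split => // -[|i] //; exact: h.
Qed.

Lemma first_hit0 (b : nat -> bool) : first_hit b 0 = b 0%N.
Proof. by apply/first_hitP/idP => [[]|b0]. Qed.

Lemma stopped_time_hit (b : nat -> bool) (k m : nat) :
  first_hit b k -> stopped_time b m = minn k.+1 m.
Proof.
elim: m b k => [|m IH] b k //=.
case: k => [|k]; first by rewrite first_hit0 => ->; rewrite minnSS min0n.
rewrite first_hitS => /andP[/negbTE -> /IH ->].
by rewrite -minnSS.
Qed.

Lemma stopped_time_nohit (b : nat -> bool) (m : nat) :
  (forall i, (i < m)%N -> ~~ b i) -> stopped_time b m = m.
Proof.
elim: m b => [|m IH] b //= h.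
by rewrite (negbTE (h 0%N _))// IH// => i im; exact: h.
Qed.

Lemma first_hit_or_none (b : nat -> bool) (m : nat) :
  (exists2 k, (k < m)%N & first_hit b k) \/ (forall i, (i < m)%N -> ~~ b i).
Proof.
elim: m b => [|m IH] b; first by right.
case b0 : (b 0%N); first by left; exists 0%N => //; rewrite first_hit0.
have [[k km hk]|h] := IH (fun i => b i.+1).
  by left; exists k.+1 => //; rewrite first_hitS b0.
by right => -[|i] //; [rewrite b0|exact: h].
Qed.

Lemma first_hit_inj (b : nat -> bool) (k l : nat) :
  first_hit b k -> first_hit b l -> k = l.
Proof.
move=> /first_hitP[bk hk] /first_hitP[bl hl].
by case: (ltngtP k l) => [/hl|/hk|//]; rewrite ?bk ?bl.
Qed.

Lemma stopped_time_gt0 (b : nat -> bool) (m : nat) :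
  (0 < m)%N -> (0 < stopped_time b m)%N.
Proof. by case: m => //= m _; case: ifP. Qed.

Lemma stopped_time_le (b : nat -> bool) (m : nat) : (stopped_time b m <= m)%N.
Proof. by elim: m b => [|m IH] b //=; case: ifP => // _; rewrite ltnS IH. Qed.

Lemma stopped_time_mono (b : nat -> bool) (m p : nat) :
  (m <= p)%N -> (stopped_time b m <= stopped_time b p)%N.
Proof. by elim: m p b => // m IH [|p] b //= mp; case: ifP => // _; rewrite ltnS IH. Qed.

(** Partition according to the place of the first success. It decomposes both the integrand and its
    conditional mean in [regeneration_mean]. The predecessor turns the length of the block back into
    the index of the success. *)
Lemma sum_first_hit {V : nmodType} (b : nat -> bool) (m : nat) (g : nat -> V) (v : V) :
  (\sum_(k < m) (if first_hit b k then g k else 0)) +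
    (if [forall i : 'I_m, ~~ b i] then v else 0) =
  if [forall i : 'I_m, ~~ b i] then v else g (stopped_time b m).-1.
Proof.
have [[k km hk]|h] := first_hit_or_none b m; last first.
  have -> : [forall i : 'I_m, ~~ b i] by apply/forallP => i; exact: h.
  rewrite big1 ?add0r// => i _; case: ifP => // /first_hitP[bi _].
  by have := h i (ltn_ord i); rewrite bi.
have -> : [forall i : 'I_m, ~~ b i] = false.
  apply/negP => /forallP/(_ (Ordinal km)) /=.
  by have /first_hitP[-> _] := hk.
rewrite addr0 (bigD1 (Ordinal km))//= hk big1 ?addr0; last first.
  move=> i ik; case: ifP => // hi; move: ik.
  by rewrite -val_eqE/= (first_hit_inj hi hk) eqxx.
by rewrite (stopped_time_hit _ hk) (minn_idPl km).
Qed.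

(** * Expectations of bounded measurable functions *)

(** A class closed under all operations needed below, so that integrability never becomes a separate
    obligation. *)
Definition bounded_mfun {R : realType} {d} {T : measurableType d} (F : T -> R) : Prop :=
  measurable_fun setT F /\ exists M : R, forall w, `|F w| <= M.

Section bounded_mfun_theory.
Context {R : realType} {d : measure_display} {T : measurableType d}.
Implicit Types (F G : T -> R) (Pr : probability T R).

Lemma bounded_mfun_integrable Pr F : bounded_mfun F ->
  Pr.-integrable setT (EFin \o F).
Proof.
move=> [mF [M FM]]; apply: measurable_bounded_integrable => //.
  by rewrite (le_lt_trans (probability_le1 _ _))// ltry.
by exists M; split; [exact: num_real|move=> x Mx w _; apply: le_trans (FM w) (ltW Mx)].
Qed.

Lemma bounded_mfun_cst (r : R) : bounded_mfun (fun _ : T => r).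
Proof. by split; [exact: measurable_cst|exists `|r|]. Qed.

Lemma bounded_mfunD F G : bounded_mfun F -> bounded_mfun G ->
  bounded_mfun (fun w => F w + G w).
Proof.
move=> [mF [M FM]] [mG [N GN]]; split; first exact: measurable_funD.
by exists (M + N) => w; apply: le_trans (ler_normD _ _) (lerD _ _).
Qed.

Lemma bounded_mfunM F G : bounded_mfun F -> bounded_mfun G ->
  bounded_mfun (fun w => F w * G w).
Proof.
move=> [mF [M FM]] [mG [N GN]]; split; first exact: measurable_funM.
by exists (M * N) => w; rewrite normrM ler_pM.
Qed.

Lemma bounded_mfunZ (r : R) F : bounded_mfun F -> bounded_mfun (fun w => r * F w).
Proof. by apply: bounded_mfunM; exact: bounded_mfun_cst. Qed.

Lemma bounded_mfunB F G : bounded_mfun F -> bounded_mfun G ->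
  bounded_mfun (fun w => F w - G w).
Proof.
move=> bF bG; under [X in bounded_mfun X]eq_fun do rewrite -mulN1r.
by apply: bounded_mfunD => //; exact: bounded_mfunZ.
Qed.

Lemma bounded_mfun_expR F : bounded_mfun F -> bounded_mfun (fun w => expR (F w)).
Proof.
move=> [mF [M FM]]; split; first exact: measurableT_comp.
exists (expR M) => w; rewrite ger0_norm ?expR_ge0// ler_expR.
by apply: le_trans (FM w); exact: ler_norm.
Qed.

Lemma bounded_mfun_if (p : T -> bool) F G : measurable_fun setT p ->
  bounded_mfun F -> bounded_mfun G -> bounded_mfun (fun w => if p w then F w else G w).
Proof.
move=> mp [mF [M FM]] [mG [N GN]]; split; first exact: measurable_fun_ifT.
exists (Num.max M N) => w; case: ifP => _; rewrite le_max ?FM ?GN ?orbT//.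
Qed.

Lemma bounded_mfun_sum (I : Type) (s : seq I) (F : I -> T -> R) :
  (forall i, bounded_mfun (F i)) -> bounded_mfun (fun w => \sum_(i <- s) F i w).
Proof.
move=> bF; elim: s => [|i s IH].
  by under [X in bounded_mfun X]eq_fun do rewrite big_nil; exact: bounded_mfun_cst.
under [X in bounded_mfun X]eq_fun do rewrite big_cons.
exact: bounded_mfunD.
Qed.

Lemma Expect_cst Pr (r : R) : \int[Pr]_w r = r.
Proof. by rewrite Rintegral_cst//= probability_setT mulr1. Qed.

Lemma ExpectD Pr F G : bounded_mfun F -> bounded_mfun G ->
  \int[Pr]_w (F w + G w) = \int[Pr]_w F w + \int[Pr]_w G w.
Proof. by move=> bF bG; rewrite RintegralD//; exact: bounded_mfun_integrable. Qed.

Lemma ExpectB Pr F G : bounded_mfun F -> bounded_mfun G ->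
  \int[Pr]_w (F w - G w) = \int[Pr]_w F w - \int[Pr]_w G w.
Proof. by move=> bF bG; rewrite RintegralB//; exact: bounded_mfun_integrable. Qed.

Lemma ExpectZ Pr (r : R) F : bounded_mfun F ->
  \int[Pr]_w (r * F w) = r * \int[Pr]_w F w.
Proof. by move=> bF; rewrite RintegralZl//; exact: bounded_mfun_integrable. Qed.

Lemma Expect_le Pr F G : bounded_mfun F -> bounded_mfun G ->
  (forall w, F w <= G w) -> \int[Pr]_w F w <= \int[Pr]_w G w.
Proof.
by move=> bF bG FG; apply: le_Rintegral => //; exact: bounded_mfun_integrable.
Qed.

Lemma Expect_sum Pr (I : Type) (s : seq I) (F : I -> T -> R) :
  (forall i, bounded_mfun (F i)) ->
  \int[Pr]_w (\sum_(i <- s) F i w) = \sum_(i <- s) \int[Pr]_w F i w.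
Proof.
move=> bF; elim: s => [|i s IH].
  by under eq_Rintegral do rewrite big_nil; rewrite Expect_cst big_nil.
under eq_Rintegral do rewrite big_cons.
by rewrite ExpectD ?IH ?big_cons//; exact: bounded_mfun_sum.
Qed.

Lemma Expect_norm_sub_le Pr F (r e : R) : bounded_mfun F ->
  (forall w, `|F w - r| <= e) -> `|\int[Pr]_w F w - r| <= e.
Proof.
move=> bF h; rewrite ler_distl; apply/andP; split.
  rewrite -[leLHS](Expect_cst Pr); apply: Expect_le => //; first exact: bounded_mfun_cst.
  by move=> w; have := h w; rewrite ler_distl => /andP[].
rewrite -[leRHS](Expect_cst Pr); apply: Expect_le => //; first exact: bounded_mfun_cst.
by move=> w; have := h w; rewrite ler_distl => /andP[].
Qed.

(** The arbitrary [h] lets the induction absorb the successor in the recursive call. *)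
Lemma measurable_stopped_time (b : nat -> T -> bool) (m : nat) (h : nat -> R) :
  (forall i, measurable_fun setT (b i)) ->
  bounded_mfun (fun w => h (stopped_time (b^~ w) m)).
Proof.
elim: m b h => [|m IH] b h mb /=; first exact: bounded_mfun_cst.
have -> : (fun w => h (if b 0 w then 1 else (stopped_time (fun i => b i.+1 w) m).+1)%N)
    = (fun w => if b 0%N w then h 1%N
                else h (stopped_time (fun i => b i.+1 w) m).+1).
  by apply/funext => w; case: ifP.
apply: bounded_mfun_if => //; first exact: bounded_mfun_cst.
exact: (IH (fun i => b i.+1) (fun k => h k.+1)).
Qed.

Lemma measurable_forall_ord (b : nat -> T -> bool) (m : nat) :
  (forall i, measurable_fun setT (b i)) ->
  measurable_fun setT (fun w => [forall i : 'I_m, ~~ b i w]).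
Proof.
move=> mb; elim: m => [|m IH].
  rewrite (_ : (fun w => _) = cst true)//.
  by apply/funext => w; apply/forallP => -[].
rewrite (_ : (fun w => _) = (fun w => [forall i : 'I_m, ~~ b i w] && ~~ b m w)).
  by apply: measurable_and => //; exact: measurable_neg.
apply/funext => w; apply/forallP/andP => [h|[/forallP h1 h2] i].
  split; last exact: (h ord_max).
  by apply/forallP => i; exact: (h (widen_ord (leqnSn m) i)).
have [->//|im] := eqVneq (nat_of_ord i) m.
have im' : (i < m)%N by move: (ltn_ord i); rewrite ltnS leq_eqVlt (negbTE im).
exact: (h1 (Ordinal im')).
Qed.

Lemma measurable_first_hit (b : nat -> T -> bool) (k : nat) :
  (forall i, measurable_fun setT (b i)) ->
  measurable_fun setT (fun w => first_hit (b^~ w) k).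
Proof. by move=> mb; apply: measurable_and => //; exact: measurable_forall_ord. Qed.
End bounded_mfun_theory.

(** * Laplace transform of a regenerative chain *)

(** From [e^u - 1 <= u e^u] follows [e^u - 1 - u <= u (e^u - 1)]. For [u >= 0] the same inequality
    bounds the right side by [u^2 e^u]; for [u < 0], [e^u >= 1 + u] bounds it by [u^2]. *)
Lemma expR_le_quadratic {R : realType} (u : R) :
  expR u <= 1 + u + u ^+ 2 * expR `|u|.
Proof.
have h1 := expR_ge1Dx (- u); have h2 := expR_ge1Dx u.
have e0 := expR_gt0 u; have eK : expR u * expR (- u) = 1 by rewrite expRxMexpNx_1.
have h3 : expR u - 1 <= expR u * u.
  have : 0 <= expR u * (expR (- u) - (1 - u)) by apply: mulr_ge0; lra.
  by rewrite !mulrBr eK mulr1; lra.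
have [u0|u0] := leP 0 u.
  rewrite ger0_norm// expr2 -mulrA.
  have : u * (expR u - 1) <= u * (expR u * u) by exact: ler_wpM2l.
  by rewrite mulrBr mulr1 [u * expR u]mulrC [expR u * u]mulrC; lra.
rewrite ltr0_norm//.
have h4 : 1 <= expR (- u) by lra.
have h5 : u ^+ 2 <= u ^+ 2 * expR (- u) by rewrite ler_peMr ?sqr_ge0.
have : 0 <= - u * (expR u - 1 - u) by apply: mulr_ge0; lra.
by rewrite expr2 in h5 *; rewrite !mulrBr mulr1 !mulNr [u * expR u]mulrC; lra.
Qed.

(** Half of the exponent absorbs the square: with [v = s / (2 c)] one has [s^2 = 4 c^2 v^2] and
    [v^2 <= 2 e^v], whence the [8]. *)
Lemma sqr_expR_le {R : realType} (s c : R) : 0 < c -> 0 <= s ->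
  s ^+ 2 * expR (s / (2 * c)) <= 8 * c ^+ 2 * expR (s / c).
Proof.
move=> c0 s0; set v := s / (2 * c).
have v0 : 0 <= v by rewrite divr_ge0//; lra.
have -> : s / c = v + v by rewrite /v; field; lra.
have -> : s = v * (2 * c) by rewrite /v; field; lra.
rewrite expRD [leRHS]mulrA ler_wpM2r ?expR_ge0//.
have := @expR_ge1Dxn R v 1 v0; rewrite (_ : 2`!%:R = 2)// => h.
have c20 : 0 <= c ^+ 2 by exact: sqr_ge0.
have : 0 <= 8 * c ^+ 2 * (expR v - (1 + v ^+ 2 / 2)).
  by apply: mulr_ge0; [exact: mulr_ge0|rewrite subr_ge0].
by rewrite !exprMn; move: (c ^+ 2) (v ^+ 2) (expR v) c20 => C V E C0; lra.
Qed.

(* Integrating out everything that comes after a regeneration at time [k + 1]. *)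
Definition regenerates {R : realType} {d d1 d2} {S : measurableType d}
    {O1 : measurableType d1} {O2 : measurableType d2} (n : nat)
    (Pr1 : probability O1 R) (X1 : nat -> O1 -> S) (b1 : nat -> O1 -> bool)
    (Pr2 : probability O2 R) (X2 : nat -> O2 -> S) : Prop :=
  forall F : n.-tuple S -> R, bounded_mfun F -> forall k, (k < n)%N ->
  let H w := \int[Pr2]_w2 F (prefix_tuple n (splice k.+1 (X1^~ w) (X2^~ w2))) in
  bounded_mfun H /\
  \int[Pr1]_w (if first_hit (b1^~ w) k then F (prefix_tuple n (X1^~ w)) else 0) =
  \int[Pr1]_w (if first_hit (b1^~ w) k then H w else 0).

Lemma measurable_prefix_tuple {d d1} {S : measurableType d} {O : measurableType d1}
    (n : nat) (X : nat -> O -> S) :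
  (forall i, measurable_fun setT (X i)) ->
  measurable_fun setT (fun w => prefix_tuple n (X^~ w)).
Proof.
move=> mX; apply/measurable_fun_tnthP => i.
by rewrite (_ : _ \o _ = X i)//; apply/funext => w /=; rewrite tnth_mktuple.
Qed.

Lemma measurable_splice {d d1} {S : measurableType d} {O : measurableType d1}
    (j : nat) (X Y : nat -> O -> S) :
  (forall i, measurable_fun setT (X i)) -> (forall i, measurable_fun setT (Y i)) ->
  forall i, measurable_fun setT (fun w => splice j (X^~ w) (Y^~ w) i).
Proof. by move=> mX mY i; rewrite /splice; case: (i < j)%N. Qed.

Lemma bounded_mfun_comp {R : realType} {d1 d2} {T1 : measurableType d1}
    {T2 : measurableType d2} (F : T2 -> R) (g : T1 -> T2) :
  bounded_mfun F -> measurable_fun setT g -> bounded_mfun (fun w => F (g w)).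
Proof.
move=> [mF [M FM]] mg; split; first exact: measurableT_comp.
by exists M => w.
Qed.

Section laplace.
Context {R : realType} {d d2 : measure_display} {S : measurableType d}
  {O2 : measurableType d2} (n : nat)
  (Pr2 : probability O2 R) (X2 : nat -> O2 -> S)
  (mX2 : forall i, measurable_fun setT (X2 i)).

Definition fresh_mean (F : n.-tuple S -> R) (j : nat) (x : nat -> S) : R :=
  \int[Pr2]_w F (prefix_tuple n (splice j x (X2^~ w))).

Lemma fresh_mean_full (F : n.-tuple S -> R) (x : nat -> S) :
  fresh_mean F n x = F (prefix_tuple n x).
Proof.
rewrite /fresh_mean; under eq_Rintegral do rewrite prefix_tuple_splice.
exact: Expect_cst.
Qed.

Lemma bounded_mfun_splice {d1} {O1 : measurableType d1} (X1 : nat -> O1 -> S)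
    (F : n.-tuple S -> R) (j : nat) (x : nat -> S) :
  (forall i, measurable_fun setT (X1 i)) -> bounded_mfun F ->
  bounded_mfun (fun w => F (prefix_tuple n (splice j x (X1^~ w)))).
Proof.
move=> mX bF; apply: bounded_mfun_comp => //; apply: measurable_prefix_tuple.
by apply: (@measurable_splice _ _ _ _ j (fun i _ => x i) X1).
Qed.

(** Freezing a prefix becomes a change of test function, to which [regenerates] applies. The default
    [x 0] of [nth] is never read, since [i - j < n]. *)
Lemma bounded_mfun_precomp_splice (F : n.-tuple S -> R) (j : nat) (x : nat -> S) :
  bounded_mfun F -> bounded_mfun (fun u : n.-tuple S =>
    F (prefix_tuple n (splice j x (nth (x 0%N) u)))).
Proof.
move=> bF; apply: bounded_mfun_comp => //; apply/measurable_fun_tnthP => i.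
rewrite (_ : _ \o _ = fun u : n.-tuple S => splice j x (nth (x 0%N) u) i); last first.
  by apply/funext => w /=; rewrite tnth_mktuple.
rewrite /splice; case: (i < j)%N => //; have ijn : (i - j < n)%N by move: (ltn_ord i); lia.
rewrite (_ : (fun u => _) = @tnth _ S ^~ (Ordinal ijn)); first exact: measurable_tnth.
by apply/funext => u; rewrite (tnth_nth (x 0%N)).
Qed.

Section one_chain.
Context {d1 : measure_display} {O1 : measurableType d1}
  (Pr1 : probability O1 R) (X1 : nat -> O1 -> S) (b1 : nat -> O1 -> bool)
  (mX1 : forall i, measurable_fun setT (X1 i))
  (mb1 : forall i, measurable_fun setT (b1 i))
  (reg : regenerates n Pr1 X1 b1 Pr2 X2).

Lemma regenerates_splice (F : n.-tuple S -> R) (j k : nat) (x : nat -> S) :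
  bounded_mfun F -> (j + k < n)%N ->
  let H w := fresh_mean F (j + k.+1) (splice j x (X1^~ w)) in
  bounded_mfun H /\
  \int[Pr1]_w (if first_hit (b1^~ w) k then F (prefix_tuple n (splice j x (X1^~ w)))
               else 0) =
  \int[Pr1]_w (if first_hit (b1^~ w) k then H w else 0).
Proof.
move=> bF jkn.
have nthE (y : nat -> S) : prefix_tuple n (splice j x (nth (x 0%N) (prefix_tuple n y)))
    = prefix_tuple n (splice j x y).
  apply: eq_prefix_tuple => i ni; rewrite /splice; case: ifP => // _.
  have ijn : (i - j < n)%N by lia.
  by rewrite -(tnth_nth (x 0%N) _ (Ordinal ijn)) tnth_mktuple.
have kn : (k < n)%N by lia.
move=> H; pose Fj u := F (prefix_tuple n (splice j x (nth (x 0%N) u))).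
have HE w : \int[Pr2]_w2 Fj (prefix_tuple n (splice k.+1 (X1^~ w) (X2^~ w2))) = H w.
  by apply: eq_Rintegral => w2 _; rewrite /Fj nthE spliceA.
have [bH eqH] := reg (bounded_mfun_precomp_splice j x bF) kn; split.
  by have -> : H = (fun w => \int[Pr2]_w2
      Fj (prefix_tuple n (splice k.+1 (X1^~ w) (X2^~ w2)))) by apply/funext.
transitivity (\int[Pr1]_w (if first_hit (b1^~ w) k then Fj (prefix_tuple n (X1^~ w)) else 0)).
  by apply: eq_Rintegral => w _; rewrite /Fj nthE.
by rewrite eqH; apply: eq_Rintegral => w _; rewrite -HE.
Qed.

(** Optional stopping at the capped regeneration time. Each possible value of the time is handled by
    [regenerates]; if no regeneration occurs, all [n] arguments are frozen and the fresh mean is [F]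
    itself. *)
Lemma regeneration_mean (F : n.-tuple S -> R) (j : nat) (x : nat -> S) :
  bounded_mfun F -> (j <= n)%N ->
  let H w := fresh_mean F (j + stopped_time (b1^~ w) (n - j)) (splice j x (X1^~ w)) in
  bounded_mfun H /\
  \int[Pr1]_w F (prefix_tuple n (splice j x (X1^~ w))) = \int[Pr1]_w H w.
Proof.
move=> bF jn H; set m := (n - j)%N in H *.
pose Phi w := F (prefix_tuple n (splice j x (X1^~ w))).
have bPhi : bounded_mfun Phi by exact: bounded_mfun_splice.
pose none w := if [forall i : 'I_m, ~~ b1 i w] then Phi w else 0.
have bnone : bounded_mfun none.
  by apply: bounded_mfun_if => //; [exact: measurable_forall_ord|exact: bounded_mfun_cst].
pose hit (G : nat -> O1 -> R) (k : 'I_m) w := if first_hit (b1^~ w) k then G k w else 0.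
have bhit (G : nat -> O1 -> R) : (forall k : 'I_m, bounded_mfun (G k)) -> forall k, bounded_mfun (hit G k).
  move=> bG k; apply: bounded_mfun_if => //; last exact: bounded_mfun_cst.
  exact: measurable_first_hit.
have PhiE w : Phi w = \sum_(k < m) hit (fun _ => Phi) k w + none w.
  by rewrite (sum_first_hit (b1^~ w) m (fun _ => Phi w)) if_same.
pose G k w := fresh_mean F (j + k.+1) (splice j x (X1^~ w)).
have bG (k : 'I_m) : bounded_mfun (G k).
  by apply: (regenerates_splice x bF _).1; move: (ltn_ord k); rewrite /m; lia.
have HE w : H w = \sum_(k < m) hit G k w + none w.
  rewrite (sum_first_hit (b1^~ w) m (G^~ w)); case: ifPn => [/forallP h|h].
    rewrite /H stopped_time_nohit ?subnKC ?fresh_mean_full// => i im.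
    exact: (h (Ordinal im)).
  rewrite /H /G prednK//; apply: stopped_time_gt0; rewrite lt0n.
  by apply: contra h => /eqP ->; apply/forallP => -[].
have -> : H = fun w => \sum_(k < m) hit G k w + none w by apply/funext.
have bS := bounded_mfun_sum (index_enum 'I_m) (bhit _ bG).
have bS' := bounded_mfun_sum (index_enum 'I_m) (bhit (fun=> Phi) (fun=> bPhi)).
split; first exact: bounded_mfunD.
transitivity (\int[Pr1]_w (\sum_(k < m) hit (fun=> Phi) k w + none w)).
  by apply: eq_Rintegral => w _; rewrite -PhiE.
rewrite !ExpectD//; congr (_ + _).
rewrite !Expect_sum; [|exact: bhit|by apply: bhit => k; exact: bPhi].
apply: eq_bigr => k _; apply: (regenerates_splice x bF _).2.
by move: (ltn_ord k); rewrite /m; lia.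
Qed.
End one_chain.
End laplace.

(** * Block-by-block Laplace bound for a symmetric Lipschitz function *)

Section symmetric_lipschitz.
Context {R : realType} {d d2 : measure_display} {S : measurableType d}
  {O2 : measurableType d2} (n : nat)
  (Pr2 : probability O2 R) (X2 : nat -> O2 -> S)
  (mX2 : forall i, measurable_fun setT (X2 i)).
Variables (f : n.-tuple S -> R) (L : R).
Hypotheses (mf : measurable_fun setT f) (L0 : 0 <= L)
  (fsym : forall (s : 'S_n) (u : n.-tuple S), f [tuple tnth u (s i) | i < n] = f u)
  (fL : forall u v : n.-tuple S, `|f u - f v| <= L * (hamming u v)%:R).

Lemma lipschitz_oscillation (u v : n.-tuple S) : `|f u - f v| <= L * n%:R.
Proof.
apply: le_trans (fL u v) _; rewrite ler_wpM2l// ler_nat.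
by rewrite -[leqRHS]card_ord; exact: max_card.
Qed.

Lemma bounded_mfun_lipschitz : bounded_mfun f.
Proof.
split => //; have [[u0 _]|no] := pselect (exists u0 : n.-tuple S, True); last first.
  by exists 0 => u; exfalso; apply: no; exists u.
exists (L * n%:R + `|f u0|) => u; rewrite -[f u](subrK (f u0)).
by apply: le_trans (ler_normD _ _) _; rewrite lerD2r lipschitz_oscillation.
Qed.

Let bf := bounded_mfun_lipschitz.

(** A coupling: both means are taken over the same fresh path, so the bound for spliced paths holds
    pointwise under the integral. *)
Lemma fresh_mean_lipschitz (j k : nat) (x y : nat -> S) : (j + k <= n)%N ->
  `|fresh_mean Pr2 X2 f (j + k) (splice j x y) - fresh_mean Pr2 X2 f j x| <= L * k%:R.
Proof.
move=> jkn; rewrite /fresh_mean -ExpectB; [|exact: bounded_mfun_splice..].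
rewrite -[X in `|X|]subr0; apply: Expect_norm_sub_le.
  by apply: bounded_mfunB; exact: bounded_mfun_splice.
by move=> w; rewrite subr0; exact: symmetric_lipschitz_splice.
Qed.

Variables (c lam : R).
Hypotheses (c0 : 0 < c) (lam0 : 0 <= lam) (lamL : lam * L <= (2 * c)^-1).

Let expf (u : n.-tuple S) : R := expR (lam * f u).
(** The cost of one block: [8] from [sqr_expR_le] times the bound [3] on the exponential moment of a
    block. *)
Let a : R := 24 * (lam * L * c) ^+ 2.

Let bexpf : bounded_mfun expf.
Proof. by apply: bounded_mfun_expR; exact: bounded_mfunZ. Qed.

(** The current chain may differ from the fresh one that continues it, so this serves both as the
    induction step and as the last step, for the first block. *)
Lemma laplace_one_block {d1 : measure_display} {O1 : measurableType d1}
    (Pr1 : probability O1 R) (X1 : nat -> O1 -> S) (b1 : nat -> O1 -> bool) (j : nat) :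
  (forall i, measurable_fun setT (X1 i)) -> (forall i, measurable_fun setT (b1 i)) ->
  regenerates n Pr1 X1 b1 Pr2 X2 ->
  \int[Pr1]_w expR ((stopped_time (b1^~ w) n)%:R / c) <= 3 ->
  (j < n)%N ->
  (forall i (x : nat -> S), (j < i <= n)%N ->
    fresh_mean Pr2 X2 expf i x <=
    expR (lam * fresh_mean Pr2 X2 f i x + a * (n - i)%:R)) ->
  forall x : nat -> S,
    \int[Pr1]_w expf (prefix_tuple n (splice j x (X1^~ w))) <=
    expR (lam * \int[Pr1]_w f (prefix_tuple n (splice j x (X1^~ w))) + a * (n - j)%:R).
Proof.
move=> mX1 mb1 reg psi jn IH x.
have [bHe ->] := regeneration_mean mX1 mb1 reg x bexpf (ltnW jn).
have [bH ->] := regeneration_mean mX1 mb1 reg x bf (ltnW jn).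
set H := (X in bounded_mfun X) in bH; set tau := fun w => stopped_time (b1^~ w) (n - j).
rewrite -[X in lam * X]/(\int[Pr1]_w H w).
(* Centring at the fresh mean makes [D] at most [L] times the block length. It need not be the mean
   of [H]; it cancels when the exponents are added. *)
pose h := fresh_mean Pr2 X2 f j x.
have a0 : 0 <= a by rewrite mulr_ge0// sqr_ge0.
have taun w : (0 < tau w /\ j + tau w <= n)%N.
  split; first by apply: stopped_time_gt0; rewrite subn_gt0.
  by have := stopped_time_le (b1^~ w) (n - j); rewrite /tau; lia.
pose D w := H w - h.
have bD : bounded_mfun D by apply: bounded_mfunB => //; exact: bounded_mfun_cst.
have DL w : `|D w| <= L * (tau w)%:R by apply: fresh_mean_lipschitz; case: (taun w).
(* Capped at [n] instead of [n - j], so that one moment hypothesis serves every [j]. *)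
pose E w := expR ((stopped_time (b1^~ w) n)%:R / c).
have bE : bounded_mfun E.
  exact: (measurable_stopped_time n (fun k => expR (k%:R / c)) mb1).
pose B := (lam * L) ^+ 2 * (8 * c ^+ 2).
have B0 : 0 <= B by rewrite mulr_ge0 ?sqr_ge0// mulr_ge0// sqr_ge0.
have expD w : expR (lam * D w) <= 1 + lam * D w + B * E w.
  apply: le_trans (expR_le_quadratic _) _; rewrite lerD2l.
  have tw : `|lam * D w| <= lam * L * (tau w)%:R.
    by rewrite normrM ger0_norm// -mulrA ler_wpM2l.
  have t0 : 0 <= (tau w)%:R :> R by [].
  apply: (@le_trans _ _ ((lam * L * (tau w)%:R) ^+ 2 * expR ((tau w)%:R / (2 * c)))).
    apply: ler_pM; rewrite ?sqr_ge0 ?expR_ge0//.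
      by rewrite -real_normK ?num_real// lerXn2r ?nnegrE// mulr_ge0// mulr_ge0.
    by rewrite ler_expR; apply: le_trans tw _; rewrite mulrC ler_wpM2l.
  rewrite exprMn -mulrA /B -[leRHS]mulrA ler_wpM2l ?sqr_ge0//.
  apply: le_trans (sqr_expR_le c0 t0) _.
  apply: ler_wpM2l; first by rewrite mulr_ge0// sqr_ge0.
  rewrite /E ler_expR; apply: ler_wpM2r; first by rewrite invr_ge0 ltW.
  by rewrite ler_nat; apply: stopped_time_mono; rewrite leq_subr.
(* As [tau w >= 1], the induction hypothesis uses at most [n - j - 1] units of the budget; the unit
   left over pays for the quadratic term of this block. *)
have step w : fresh_mean Pr2 X2 expf (j + tau w) (splice j x (X1^~ w)) <=
    expR (lam * h + a * (n - j.+1)%:R) * expR (lam * D w).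
  apply: le_trans (IH _ _ _) _; first by have := taun w; lia.
  have an : a * (n - (j + tau w))%:R <= a * (n - j.+1)%:R.
    by apply: ler_wpM2l => //; rewrite ler_nat; have := taun w; lia.
  by rewrite -expRD ler_expR -/(H w) /D; lra.
apply: le_trans (Expect_le (G := fun w => expR (lam * h + a * (n - j.+1)%:R) *
  expR (lam * D w)) Pr1 bHe _ step) _.
  by apply: bounded_mfunZ; apply: bounded_mfun_expR; exact: bounded_mfunZ.
rewrite ExpectZ; last by apply: bounded_mfun_expR; exact: bounded_mfunZ.
have intD : \int[Pr1]_w expR (lam * D w) <= expR (lam * (\int[Pr1]_w H w - h) + a).
  have bl : bounded_mfun (fun w => lam * D w) by exact: bounded_mfunZ.
  have b1l : bounded_mfun (fun w => 1 + lam * D w).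
    by apply: bounded_mfunD => //; exact: bounded_mfun_cst.
  have bBE : bounded_mfun (fun w => B * E w) by exact: bounded_mfunZ.
  apply: le_trans (Expect_le Pr1 (bounded_mfun_expR bl) (bounded_mfunD b1l bBE) expD) _.
  rewrite ExpectD// ExpectD//; last exact: bounded_mfun_cst.
  rewrite Expect_cst !ExpectZ// ExpectB//; last exact: bounded_mfun_cst.
  rewrite Expect_cst; apply: le_trans (expR_ge1Dx _); rewrite -addrA lerD2l lerD2l.
  apply: (@le_trans _ _ (B * 3)); first exact: ler_wpM2l.
  by rewrite /B /a !exprMn; lra.
apply: le_trans (ler_wpM2l (expR_ge0 _) intD) _.
rewrite -expRD ler_expR; have -> : (n - j)%:R = (n - j.+1)%:R + 1 :> R by rewrite natr1; congr _%:R; lia.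
by lra.
Qed.

Lemma laplace_fresh (b2 : nat -> O2 -> bool) :
  (forall i, measurable_fun setT (b2 i)) ->
  regenerates n Pr2 X2 b2 Pr2 X2 ->
  \int[Pr2]_w expR ((stopped_time (b2^~ w) n)%:R / c) <= 3 ->
  forall m i (x : nat -> S), (n - i <= m)%N -> (i <= n)%N ->
  fresh_mean Pr2 X2 expf i x <=
  expR (lam * fresh_mean Pr2 X2 f i x + a * (n - i)%:R).
Proof.
move=> mb2 reg psi; elim => [|m IH] i x nim ni.
  have -> : i = n by lia.
  by rewrite !fresh_mean_full subnn mulr0 addr0.
have [->|ni'] := eqVneq i n; first by rewrite !fresh_mean_full subnn mulr0 addr0.
apply: (laplace_one_block mX2 mb2 reg psi); first by rewrite ltn_neqAle ni'.
by move=> k y ikn; apply: IH; lia.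
Qed.

Lemma laplace_chain {d1 : measure_display} {O1 : measurableType d1}
    (Pr1 : probability O1 R) (X1 : nat -> O1 -> S) (b1 : nat -> O1 -> bool)
    (b2 : nat -> O2 -> bool) :
  (forall i, measurable_fun setT (X1 i)) -> (forall i, measurable_fun setT (b1 i)) ->
  (forall i, measurable_fun setT (b2 i)) ->
  regenerates n Pr1 X1 b1 Pr2 X2 -> regenerates n Pr2 X2 b2 Pr2 X2 ->
  \int[Pr1]_w expR ((stopped_time (b1^~ w) n)%:R / c) <= 3 ->
  \int[Pr2]_w expR ((stopped_time (b2^~ w) n)%:R / c) <= 3 ->
  (0 < n)%N ->
  \int[Pr1]_w expR (lam * f (prefix_tuple n (X1^~ w))) <=
  expR (lam * \int[Pr1]_w f (prefix_tuple n (X1^~ w)) +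
        24 * (lam * L * c) ^+ 2 * n%:R).
Proof.
move=> mX1 mb1 mb2 reg1 reg2 psi1 psi2 n0.
(* Some path is needed to instantiate the empty frozen prefix; a space of mass one has a point. *)
have [w0] : exists w : O1, True.
  apply: contrapT => no; have := probability_setT Pr1.
  rewrite (_ : setT = set0) ?measure0; last first.
    by apply/seteqP; split => // w _; exfalso; apply: no; exists w.
  by move=> /esym/eqP; rewrite onee_eq0.
have IH i (x : nat -> S) : (0 < i <= n)%N -> fresh_mean Pr2 X2 expf i x <=
    expR (lam * fresh_mean Pr2 X2 f i x + a * (n - i)%:R).
  by move=> /andP[_ ni]; exact: (@laplace_fresh b2 mb2 reg2 psi2 (n - i) i x (leqnn _) ni).
have := laplace_one_block mX1 mb1 reg1 psi1 n0 IH (X1^~ w0).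
have s0 (G : n.-tuple S -> R) :
    \int[Pr1]_w G (prefix_tuple n (splice 0 (X1^~ w0) (X1^~ w))) =
    \int[Pr1]_w G (prefix_tuple n (X1^~ w)).
  by apply: eq_Rintegral => w _; congr (G (prefix_tuple n _)); apply/funext => i;
    rewrite /splice subn0.
by rewrite (s0 expf) (s0 f) subn0.
Qed.
End symmetric_lipschitz.

(** * Factorisation of the split chain at a regeneration *)

Local Open Scope ereal_scope.

(** Frees the states after time [k], so that the past of a regeneration is itself a [split_tail]. *)
Definition cut_after {S : Type} (A : nat -> set S) (k l : nat) : set S :=
  if (l <= k)%N then A l else setT.

Section split_tail_theory.
Context {R : realType} {d : measure_display} {S : measurableType d}.
Variables (P : R.-pker S ~> S) (delta : R) (C : set S) (nu : probability S R).
Hypothesis minor : minorization P delta C nu.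

Let delta0 : (0 < delta)%R. Proof. by case: minor. Qed.
Let mC : measurable C. Proof. by case: minor => _ []. Qed.

(** Makes the weight of the flag [0] nonnegative. On [C] it compares the measures [delta nu] and
    [P x]; off [C] the left side is zero. *)
Lemma minorization_integral (A : set S) (g : S -> \bar R) (x : S) :
  measurable A -> measurable_fun setT g -> (forall y, 0 <= g y) ->
  (delta * \1_C x)%:E * \int[nu]_(y in A) g y <= \int[P x]_(y in A) g y.
Proof.
move=> mA mg g0; rewrite indicE; case: (boolP (x \in C)) => [|_]; last first.
  by rewrite mulr0 mul0e; exact: integral_ge0.
rewrite inE mulr1 => Cx; pose dn : {nonneg R} := NngNum (ltW delta0).
rewrite -[delta]/(dn%:num) -ge0_integral_mscale//; last exact: measurable_funTS.
apply: ge0_le_measure_integral => // B mB.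
by have [_ [_ [h _]]] := minor; exact: h.
Qed.

Lemma integral_prob_le1 (mu : {measure set S -> \bar R}) (A : set S) (g : S -> \bar R) :
  mu setT = 1 -> measurable A -> measurable_fun setT g -> (forall y, 0 <= g y <= 1) ->
  \int[mu]_(y in A) g y <= 1.
Proof.
move=> mu1 mA mg g01; apply: (@le_trans _ _ (\int[mu]_(y in A) cst 1 y)).
  apply: ge0_le_integral => //.
  - by move=> y _; case/andP: (g01 y).
  - exact: measurable_funTS.
  - by move=> y _; case/andP: (g01 y).
by rewrite integral_cst// mul1e -mu1 le_measure// inE.
Qed.

(** The two claims feed each other: the next integral is measurable because the tail is nonnegative,
    and the upper bound makes the subtraction one of finite numbers. *)
Lemma split_tail_measurable01 (r : nat -> bool) (A : nat -> set S) (k i : nat) :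
  (forall l, measurable (A l)) ->
  measurable_fun setT (split_tail P delta C nu r A k i) /\
  forall x, 0 <= split_tail P delta C nu r A k i x <= 1.
Proof.
move=> mA; elim: k i => [|k IH] i /=.
  by split => [|x]; [exact: measurable_cst|rewrite lee01 lexx].
have [mg g01] := IH i.+1; set g := split_tail P delta C nu r A k i.+1 in mg g01 *.
have g0 y : 0 <= g y by case/andP: (g01 y).
have ming x := minorization_integral x (mA i.+1) mg g0.
have nug0 : 0 <= \int[nu]_(y in A i.+1) g y by exact: integral_ge0.
have w0 x : 0 <= (delta * \1_C x)%:E by rewrite lee_fin mulr_ge0// ltW.
have Pg1 x : \int[P x]_(y in A i.+1) g y <= 1.
  by apply: integral_prob_le1 => //; exact: prob_kernel.
have mw : measurable_fun setT (fun x => (delta * \1_C x)%:E * \int[nu]_(y in A i.+1) g y).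
  apply: emeasurable_funM => //; apply/measurable_EFinP.
  by apply: measurable_funM => //; exact: measurable_indic.
have mPg : measurable_fun setT (fun x => \int[P x]_(y in A i.+1) g y).
  under eq_fun do rewrite integral_mkcond.
  apply: (measurable_fun_integral_kernel (measurable_kernel P)).
    by move=> y; apply: erestrict_ge0.
  by apply/(measurable_restrictT _ _).1 => //; exact: measurable_funTS.
have Pgfin x : \int[P x]_(y in A i.+1) g y \is a fin_num.
  by rewrite ge0_fin_numE ?integral_ge0// (le_lt_trans (Pg1 x))// ltry.
case: (r i).
  split => // x; rewrite mule_ge0//=.
  exact: le_trans (ming x) (Pg1 x).
split; first exact: emeasurable_funB.
move=> x; rewrite sube_ge0 ?Pgfin ?orbT// ming/=.
by rewrite (le_trans _ (Pg1 x))// geeDl// oppe_le0 mule_ge0.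
Qed.

Lemma fin_num_integral01 (mu : {measure set S -> \bar R}) (A : set S) (g : S -> \bar R) :
  mu setT = 1 -> measurable A -> measurable_fun setT g -> (forall y, 0 <= g y <= 1) ->
  \int[mu]_(y in A) g y \is a fin_num.
Proof.
move=> mu1 mA mg g01; rewrite ge0_fin_numE; last first.
  by apply: integral_ge0 => y _; case/andP: (g01 y).
by rewrite (le_lt_trans (integral_prob_le1 mu1 mA mg g01))// ltry.
Qed.

Lemma split_tail_shift (r : nat -> bool) (A : nat -> set S) (k j i : nat) :
  split_tail P delta C nu r A k (j + i) =
  split_tail P delta C nu (fun l => r (j + l)%N) (fun l => A (j + l)%N) k i.
Proof.
elim: k i => [|k IH] i //; apply/funext => x /=.
by rewrite -addnS IH.
Qed.

(* The constant on the right is the mass of the future of a regeneration at time [i + k]. *)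
Lemma split_tail_regeneration (r : nat -> bool) (A : nat -> set S) (k m i : nat) (x : S) :
  (forall l, measurable (A l)) -> r (i + k)%N ->
  split_tail P delta C nu r A (k + m.+1) i x =
  split_tail P delta C nu r (cut_after A (i + k)) k.+1 i x *
  \int[nu]_(y in A (i + k).+1) split_tail P delta C nu r A m (i + k).+1 y.
Proof.
move=> mA; elim: k i x => [|k IH] i x rik.
  rewrite addn0 in rik *; rewrite /= rik /cut_after ltnn; congr (_ * _).
  by rewrite integral_cst// mul1e [X in _ * X]probability_setT mule1.
rewrite [(i + k.+1)%N]addnS in rik *; rewrite [(k.+1 + _)%N]addSn.
set c := \int[nu]_(y in _) _.
have mcut l : measurable (cut_after A (i + k).+1 l) by rewrite /cut_after; case: ifP.
have [mg' g'01] := split_tail_measurable01 r k.+1 i.+1 mcut.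
set g' := split_tail _ _ _ _ _ _ _ _ in mg' g'01.
have gE y : split_tail P delta C nu r A (k + m.+1) i.+1 y = g' y * c.
  by rewrite IH// addSn.
have cutE : cut_after A (i + k).+1 i.+1 = A i.+1.
  by rewrite /cut_after ltnS leq_addr.
have c0 : 0 <= c.
  apply: integral_ge0 => y _.
  by case/andP: ((split_tail_measurable01 r m (i + k).+2 mA).2 y).
have intE (mu : {measure set S -> \bar R}) :
    \int[mu]_(y in A i.+1) split_tail P delta C nu r A (k + m.+1) i.+1 y =
    (\int[mu]_(y in A i.+1) g' y) * c.
  under eq_integral do rewrite gE.
  rewrite ge0_integralZr//; first exact: measurable_funTS.
  by move=> y _; case/andP: (g'01 y).
rewrite [LHS]/= [in RHS](_ : split_tail _ _ _ _ _ _ k.+2 i x =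
  if r i then (delta * \1_C x)%:E * \int[nu]_(y in A i.+1) g' y
  else \int[P x]_(y in A i.+1) g' y - (delta * \1_C x)%:E * \int[nu]_(y in A i.+1) g' y); last first.
  by rewrite -cutE.
rewrite !intE; case: (r i); first by rewrite muleA.
have nufin : \int[nu]_(y in A i.+1) g' y \is a fin_num.
  by apply: fin_num_integral01 => //; exact: probability_setT.
have Pfin : \int[P x]_(y in A i.+1) g' y \is a fin_num.
  by apply: fin_num_integral01 => //; exact: prob_kernel.
have cfin : c \is a fin_num.
  have [mt t01] := split_tail_measurable01 r m (i + k).+2 mA.
  by apply: fin_num_integral01 => //; exact: probability_setT.
move: (\int[P x]_(y in A i.+1) g' y) (\int[nu]_(y in A i.+1) g' y) Pfin nufin => a b af bf.
by rewrite muleBl ?muleA// fin_num_adde_defr// fin_numN fin_numM.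
Qed.

Lemma split_mass_regeneration (xi : probability S R) (r : nat -> bool)
    (A : nat -> set S) (k m : nat) :
  (forall l, measurable (A l)) -> r k.+1 ->
  \int[xi]_(x in A 1%N) split_tail P delta C nu r A (k + m.+1) 1 x =
  \int[xi]_(x in A 1%N) split_tail P delta C nu r (cut_after A k.+1) k.+1 1 x *
  \int[nu]_(y in A k.+2) split_tail P delta C nu
     (fun l => r (k.+1 + l)%N) (fun l => A (k.+1 + l)%N) m 1 y.
Proof.
move=> mA rk; rewrite -split_tail_shift addn1.
have mcut l : measurable (cut_after A k.+1 l) by rewrite /cut_after; case: ifP.
have [mg' g'01] := split_tail_measurable01 r k.+1 1 mcut.
under eq_integral do rewrite split_tail_regeneration// add1n.
rewrite ge0_integralZr//; first exact: measurable_funTS.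
  by move=> y _; case/andP: (g'01 y).
apply: integral_ge0 => y _.
by case/andP: ((split_tail_measurable01 r m k.+2 mA).2 y).
Qed.
End split_tail_theory.

(** * From boxes to bounded functions of the path *)

Lemma measurable_box {dT d} {U : measurableType dT} {V : measurableType d} (n : nat)
    (Y : nat -> U -> V) (A : nat -> set V) :
  (forall i, measurable_fun setT (Y i)) -> (forall i, measurable (A i)) ->
  measurable [set w | forall i, (i < n)%N -> A i (Y i w)].
Proof.
move=> mY mA; rewrite (_ : [set _ | _] = \bigcap_(i in `I_n) (Y i @^-1` A i))//.
apply: fin_bigcap_measurable => // i _.
by rewrite -[X in measurable X]setTI; exact: mY.
Qed.

(** Boxes are stable under intersection and generate the sigma-algebra of tuples. *)
Lemma measure_tuple_unique {R : realType} {d} {S : measurableType d} (n : nat)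
    (m1 m2 : {measure set (n.-tuple S) -> \bar R}) :
  m1 setT < +oo ->
  (forall A : 'I_n -> set S, (forall i, measurable (A i)) ->
    m1 [set u | forall i, A i (tnth u i)] = m2 [set u | forall i, A i (tnth u i)]) ->
  forall B, measurable B -> m1 B = m2 B.
Proof.
move=> m1oo m12 B mB.
pose box (A : 'I_n -> set S) := [set u : n.-tuple S | forall i, A i (tnth u i)].
pose G := [set box A | A in [set A | forall i, measurable (A i)]].
have boxT : box (fun=> setT) = setT by apply/seteqP; split.
apply: (@measure_unique _ _ _ G (fun=> setT)) => //.
- apply/seteqP; split.
    apply: smallest_sub; first exact: smallest_sigma_algebra.
    move=> C; rewrite -bigcup_seq => -[i _] [D mD <-]; apply: sub_sigma_algebra.
    exists (fun j => if j == i then D else setT).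
      by move=> j /=; case: ifP.
    apply/seteqP; split => u /=.
      by move=> /(_ i); rewrite eqxx.
    by move=> [_ Du] j; case: eqP => [->|].
  apply: smallest_sub; first exact: sigma_algebra_measurable.
  move=> _ [A mA <-]; rewrite (_ : box A = \bigcap_(i in setT) ((@tnth _ S)^~ i @^-1` A i)).
    apply: fin_bigcap_measurable; first exact: finite_finset.
    move=> i _; rewrite -[X in measurable X]setTI.
    by apply: measurable_tnth => //; exact: mA.
  by apply/seteqP; split => u /= h i; [move=> _|]; exact: h.
- move=> _ _ [A mA <-] [A' mA' <-]; exists (fun i => A i `&` A' i).
    by move=> i; apply: measurableI; [exact: mA|exact: mA'].
  apply/seteqP; split => u /=; first by move=> h; split => i; case: (h i).
  by move=> [h h'] i; split.
- by move=> _; exists (fun=> setT).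
- by rewrite bigcup_const//; exists 0%N.
- by move=> _ [A mA <-]; exact: m12.
Qed.

Lemma integral_mrestr {R : realType} {d} {T : measurableType d}
    (mu : {measure set T -> \bar R}) (D : set T) (mD : measurable D) (f : T -> \bar R) :
  measurable_fun setT f ->
  \int[mrestr mu mD]_x f x = \int[mu]_(x in D) f x.
Proof.
have nneg (g : T -> \bar R) : measurable_fun setT g -> (forall x, 0 <= g x) ->
    \int[mrestr mu mD]_x g x = \int[mu]_(x in D) g x.
  move=> mg g0; transitivity (\int[mrestr mu mD]_(x in setT `\` ~` D) g x).
    apply: ge0_negligible_integral => //; first exact: measurableC.
    by rewrite /= /mrestr setICl measure0.
  rewrite setTD setCK; apply: eq_measure_integral => A mA AD.
  by rewrite /= /mrestr setIidl.
move=> mf; rewrite [LHS]integralE [RHS]integralE !nneg//.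
  exact: measurable_funeneg.
exact: measurable_funepos.
Qed.

Section regenerates_of_boxes.
Context {R : realType} {d d1 d2 : measure_display} {S : measurableType d}
  {O1 : measurableType d1} {O2 : measurableType d2} (n : nat)
  (Pr1 : probability O1 R) (X1 : nat -> O1 -> S) (b1 : nat -> O1 -> bool)
  (Pr2 : probability O2 R) (X2 : nat -> O2 -> S).
Hypotheses (mX1 : forall i, measurable_fun setT (X1 i))
  (mb1 : forall i, measurable_fun setT (b1 i))
  (mX2 : forall i, measurable_fun setT (X2 i)).

Lemma measurable_first_hit_set (k : nat) :
  measurable [set w | first_hit (b1^~ w) k].
Proof.
rewrite -[X in measurable X]setTI.
by have := @measurable_first_hit _ _ b1 k mb1 measurableT [set true] I.
Qed.

(** Two image measures on [n]-tuples are compared: that of [Pr1] restricted to the event, and that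
    of its product with [Pr2] under splicing. The hypothesis says that they agree on boxes; Fubini
    turns the second into the integral of [H]. *)
Lemma regenerates_of_boxes :
  (forall k (A : nat -> set S), (k < n)%N -> (forall i, measurable (A i)) ->
    Pr1 [set w | first_hit (b1^~ w) k /\ forall i, (i < n)%N -> A i (X1 i w)] =
    Pr1 [set w | first_hit (b1^~ w) k /\ forall i, (i < k.+1)%N -> A i (X1 i w)] *
    Pr2 [set w | forall i, (i < n - k.+1)%N -> A (k.+1 + i)%N (X2 i w)]) ->
  regenerates n Pr1 X1 b1 Pr2 X2.
Proof.
move=> boxE F bF k kn H.
pose D := [set w | first_hit (b1^~ w) k].
have mD : measurable D by exact: measurable_first_hit_set.
pose phi1 w := prefix_tuple n (X1^~ w).
pose phi2 (z : O1 * O2) := prefix_tuple n (splice k.+1 (X1^~ z.1) (X2^~ z.2)).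
have mphi1 : measurable_fun setT phi1 by exact: measurable_prefix_tuple.
have mphi2 : measurable_fun setT phi2.
  apply: measurable_prefix_tuple.
  apply: (@measurable_splice _ _ _ _ k.+1 (fun i z => X1 i z.1) (fun i z => X2 i z.2)).
    by move=> i; exact: measurableT_comp.
  by move=> i; exact: measurableT_comp.
pose mu : {finite_measure set O1 -> \bar R} := mrestr Pr1 mD.
pose push1 : {measure set (n.-tuple S) -> \bar R} := pushforward mu phi1.
pose push2 : {measure set (n.-tuple S) -> \bar R} := pushforward (mu \x Pr2)%E phi2.
have m12 B : measurable B -> push1 mphi1 B = push2 mphi2 B.
  apply: measure_tuple_unique.
    by rewrite /= /pushforward preimage_setT -ge0_fin_numE// fin_num_measure.
  (* Extends the box to all natural indices; from [n] on the default [setT] imposes nothing. *)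
  move=> A0 mA0; pose A i := if insub i is Some o then A0 o else setT.
  have mA i : measurable (A i) by rewrite /A; case: insub.
  have AE (o : 'I_n) : A o = A0 o by rewrite /A valK.
  rewrite /= /pushforward /mrestr.
  rewrite (_ : _ `&` D = [set w | first_hit (b1^~ w) k /\ forall i, (i < n)%N -> A i (X1 i w)]);
      last first.
    apply/seteqP; split => w /=.
      move=> [h hk]; split => // i ni; have := h (Ordinal ni).
      by rewrite -AE tnth_mktuple.
    by move=> [hk h]; split => // i; rewrite -AE tnth_mktuple; exact: h.
  rewrite boxE//.
  rewrite (_ : _ @^-1` _ = [set w | forall i, (i < k.+1)%N -> A i (X1 i w)] `*`
     [set w | forall i, (i < n - k.+1)%N -> A (k.+1 + i)%N (X2 i w)]); last first.
    apply/seteqP; split => -[w w2] /=.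
      move=> h; split => i ik.
        have ni : (i < n)%N by exact: leq_trans kn.
        by have := h (Ordinal ni); rewrite -AE tnth_mktuple /= /splice ik.
      have ni : (k.+1 + i < n)%N by rewrite -ltn_subRL.
      have := h (Ordinal ni); rewrite -AE tnth_mktuple /= /splice.
      by rewrite ltnNge leq_addr/= addKn.
    move=> [h1 h2] i; rewrite -AE tnth_mktuple /= /splice; case: ltnP => ik; first exact: h1.
    by rewrite -{1}(subnKC ik); apply: h2; rewrite ltn_sub2r// (leq_ltn_trans ik).
  have mU := measurable_box k.+1 mX1 mA.
  have mV := measurable_box (n - k.+1) mX2 (fun i => mA (k.+1 + i)%N).
  apply: esym; apply: etrans (product_measure1E mu Pr2 mU mV) _.
  by congr (_ * _); rewrite /= /mrestr; congr (Pr1 _); apply/seteqP; split => w /= [].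
have bF2 : bounded_mfun (F \o phi2) by exact: bounded_mfun_comp.
have bF1 : bounded_mfun (F \o phi1) by exact: bounded_mfun_comp.
have fin_integrable dT (T : measurableType dT) (m : {measure set T -> \bar R})
    (g : T -> R) : m setT < +oo -> bounded_mfun g -> m.-integrable setT (EFin \o g).
  move=> moo [mg [M gM]]; apply: measurable_bounded_integrable => //.
  by exists M; split; [exact: num_real|move=> x Mx w _; apply: le_trans (gM w) (ltW Mx)].
have muoo : mu setT < +oo by rewrite -ge0_fin_numE// fin_num_measure.
have intF2 : (mu \x Pr2).-integrable setT (EFin \o (F \o phi2)).
  apply: fin_integrable => //; rewrite -setXTT.
  rewrite [X in X < _](product_measure1E mu Pr2 measurableT measurableT).
  by rewrite [X in _ * X]probability_setT mule1.
have HE w : (H w)%:E = fubini_F Pr2 (EFin \o (F \o phi2)) w.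
  rewrite /H /Rintegral fineK//; apply: integrable_fin_num => //.
  apply: (bounded_mfun_integrable Pr2 (F := fun w2 => F (phi2 (w, w2)))).
  by apply: bounded_mfun_comp => //; apply: measurableT_comp => //; exact: pair1_measurable.
have bH : bounded_mfun H.
  split.
    apply/measurable_EFinP; rewrite (_ : _ \o _ = fubini_F Pr2 (EFin \o (F \o phi2))).
      apply: measurable_int (integrable_fubini_F (m1 := Pr1) (m2 := Pr2) _).
      by apply: bounded_mfun_integrable.
    by apply/funext => w; exact: HE.
  have [_ [M FM]] := bF; exists M => w; rewrite -[H w]subr0.
  apply: Expect_norm_sub_le => [|w2]; last by rewrite subr0.
  apply: (bounded_mfun_comp (g := fun w2 => phi2 (w, w2))) => //.
  by apply: measurableT_comp => //; exact: pair1_measurable.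
have onD (g : O1 -> R) : measurable_fun setT g ->
    \int[Pr1]_w (if first_hit (b1^~ w) k then g w else 0%R)%:E = \int[mu]_w (g w)%:E.
  move=> mg; rewrite integral_mrestr; last exact/measurable_EFinP.
  rewrite integral_mkcond; apply: eq_integral => w _; rewrite patchE.
  by case: ifPn => hk; [rewrite mem_set|rewrite memNset//; exact/negP].
split => //; rewrite /Rintegral; congr fine.
rewrite (onD (F \o phi1)); last by case: bF1.
rewrite (onD H); last by case: bH.
transitivity (\int[push1 mphi1]_u (F u)%:E).
  rewrite integral_pushforward//; first by apply/measurable_EFinP; case: bF.
  by rewrite preimage_setT; exact: fin_integrable.
transitivity (\int[push2 mphi2]_u (F u)%:E).
  by apply: eq_measure_integral => B mB _; exact: m12.
rewrite integral_pushforward//; last by apply/measurable_EFinP; case: bF.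
rewrite preimage_setT -[LHS](integral12_prod_meas1 (m1 := mu) (m2 := Pr2))//.
by apply: eq_integral => w _; rewrite HE.
Qed.
End regenerates_of_boxes.

(** * Factorisation and restart of the split chain *)

Definition split_event {O S : Type} (X : nat -> O -> S) (Rg : nat -> O -> bool)
    (K J : nat) (r : nat -> bool) (A : nat -> set S) : set O :=
  [set w | (forall i, (i < K.+1)%N -> A i.+1 (X i.+1 w)) /\
           (forall i, (i < J)%N -> Rg i.+1 w = r i.+1)].

Definition set_bit (r : nat -> bool) (j : nat) (b : bool) (i : nat) : bool :=
  if i == j then b else r i.

Lemma measurable_split_event {d dO} {S : measurableType d} {O : measurableType dO}
    (X : nat -> O -> S) (Rg : nat -> O -> bool) K J r A :
  (forall i, measurable_fun setT (X i)) -> (forall i, measurable_fun setT (Rg i)) ->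
  (forall i, measurable (A i)) -> measurable (split_event X Rg K J r A).
Proof.
move=> mX mR mA; apply: measurableI.
  exact: (measurable_box K.+1 (fun i => mX i.+1) (fun i => mA i.+1)).
exact: (measurable_box (A := fun i => [set r i.+1]) J (fun i => mR i.+1)).
Qed.

Lemma eq_split_event {O S : Type} (X : nat -> O -> S) (Rg : nat -> O -> bool) K J r r' A A' :
  (forall i, (0 < i <= J)%N -> r i = r' i) -> (forall i, (0 < i <= K.+1)%N -> A i = A' i) ->
  split_event X Rg K J r A = split_event X Rg K J r' A'.
Proof.
move=> rr AA; apply/seteqP; split => w [h1 h2]; split => i iK.
- by rewrite -AA//; exact: h1.
- by rewrite -rr// h2.
- by rewrite AA//; exact: h1.
- by rewrite rr// h2.
Qed.

(** [is_split_chain] prescribes a flag for every step, whereas [regenerates] leaves the flags after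
    the regeneration free; summing over the two values of the next flag bridges the gap. *)
Lemma split_event_bit {R : realType} {d dO} {S : measurableType d} {O : measurableType dO}
    (Pr : probability O R) (X : nat -> O -> S) (Rg : nat -> O -> bool) K J r A :
  (forall i, measurable_fun setT (X i)) -> (forall i, measurable_fun setT (Rg i)) ->
  (forall i, measurable (A i)) ->
  Pr (split_event X Rg K J r A) =
  Pr (split_event X Rg K J.+1 (set_bit r J.+1 true) A) +
  Pr (split_event X Rg K J.+1 (set_bit r J.+1 false) A).
Proof.
move=> mX mR mA; rewrite -measureU; [|exact: measurable_split_event..|]; last first.
  apply/seteqP; split => // w [[_ h1] [_ h2]]; have := h1 J (ltnSn J).
  by rewrite h2// /set_bit eqxx.
congr (Pr _); apply/seteqP; split => w.
  move=> [h1 h2]; case RJ : (Rg J.+1 w); [left|right]; split => // i iJ; rewrite /set_bit;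
    by case: eqP => [[->]|ne] //; apply: h2; lia.
have key b : split_event X Rg K J.+1 (set_bit r J.+1 b) A w ->
    split_event X Rg K J r A w.
  move=> [h1 h2]; split => // i iJ; rewrite h2 /set_bit; last by lia.
  by case: eqP => //; lia.
by move=> [] /key.
Qed.

(** The conditional law given [D]. The fallback of [mnormalize] is ruled out because the mass of [D]
    is positive and finite. *)
Lemma mnormalize_mrestr {R : realType} {dO} {O : measurableType dO} (Pr : probability O R)
    (D : set O) (mD : measurable D) (E : set O) :
  0 < Pr D ->
  mnormalize (mrestr Pr mD) Pr E = Pr (E `&` D) * (fine (Pr D))^-1%:E.
Proof.
move=> D0; have Dfin : Pr D \is a fin_num by exact: fin_num_measure.
rewrite /mnormalize (_ : (Measure.sort _) setT = Pr D); last by rewrite /= /mrestr setTI.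
rewrite gt_eqF// orFb; case: eqP => // Doo.
by rewrite Doo in Dfin.
Qed.

Section split_chain.
Context {R : realType} {d : measure_display} {S : measurableType d}.
Variables (P : R.-pker S ~> S) (delta : R) (C : set S) (nu : probability S R).
Hypothesis minor : minorization P delta C nu.

Lemma split_chain_event {dO} {O : measurableType dO} (Pr : probability O R)
    (xi : probability S R) (X : nat -> O -> S) (Rg : nat -> O -> bool) K r A :
  is_split_chain Pr P xi delta C nu X Rg -> (forall i, measurable (A i)) ->
  Pr (split_event X Rg K K r A) =
  \int[xi]_(x in A 1%N) split_tail P delta C nu r A K 1 x.
Proof.
move=> sc mA; rewrite -sc//; congr (Pr _); apply/seteqP; split => w.
  move=> [h1 h2]; split; first exact: h1.
  by move=> [//|i] iK; split; [exact: h2|exact: h1].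
move=> [h1 h2]; split; first by move=> [//|i] iK; exact: (h2 i.+1 _).2.
by move=> i iK; exact: (h2 i.+1 _).1.
Qed.

Lemma split_tail_ext r r' A A' k i : (0 < i)%N ->
  (forall l, (0 < l)%N -> r l = r' l) -> (forall l, (0 < l)%N -> A l = A' l) ->
  split_tail P delta C nu r A k i = split_tail P delta C nu r' A' k i.
Proof.
move=> + rr AA; elim: k i => [|k IH] i i0 //.
by apply/funext => x /=; rewrite IH// rr// AA.
Qed.

Section two_chains.
Context {d1 d2 : measure_display} {O1 : measurableType d1} {O2 : measurableType d2}
  (Pr1 : probability O1 R) (Pr2 : probability O2 R) (xi : probability S R)
  (X1 : nat -> O1 -> S) (Rg1 : nat -> O1 -> bool)
  (X2 : nat -> O2 -> S) (Rg2 : nat -> O2 -> bool).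
Hypotheses (mX1 : forall i, measurable_fun setT (X1 i))
  (mR1 : forall i, measurable_fun setT (Rg1 i))
  (mX2 : forall i, measurable_fun setT (X2 i))
  (mR2 : forall i, measurable_fun setT (Rg2 i))
  (sc1 : is_split_chain Pr1 P xi delta C nu X1 Rg1)
  (sc2 : is_split_chain Pr2 P nu delta C nu X2 Rg2).

(** Induction on the number [K - J] of free flags. With none left this is [split_mass_regeneration];
    a further free flag lies after the regeneration, so splitting on it changes only the future
    factor. *)
Lemma split_event_regeneration (k K J : nat) (r : nat -> bool) (A : nat -> set S) :
  (k < J)%N -> (J <= K)%N -> r k.+1 -> (forall i, measurable (A i)) ->
  Pr1 (split_event X1 Rg1 K J r A) =
  Pr1 (split_event X1 Rg1 k.+1 k.+1 r (cut_after A k.+1)) *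
  Pr2 (split_event X2 Rg2 (K - k.+1) (J - k.+1)
         (fun l => r (k.+1 + l)%N) (fun l => A (k.+1 + l)%N)).
Proof.
move=> kJ JK rk mA; have mcut i : measurable (cut_after A k.+1 i).
  by rewrite /cut_after; case: ifP.
move: {2}(K - J)%N (erefl (K - J)%N) => D; elim: D J r kJ JK rk => [|D IH] J r kJ JK rk KJ.
  have JE : J = K by lia.
  rewrite {}JE in kJ *.
  rewrite !(split_chain_event _ _ sc1)// (split_chain_event _ _ sc2)// addn1.
  have := split_mass_regeneration minor xi (K - k.+1) mA rk.
  by rewrite (_ : (k + (K - k.+1).+1)%N = K); [|lia].
have {}JK : (J < K)%N by lia.
rewrite split_event_bit// !IH; try lia; last 2 first.
- by rewrite /set_bit; case: eqP => //; lia.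
- by rewrite /set_bit; case: eqP => //; lia.
have past b : split_event X1 Rg1 k.+1 k.+1 (set_bit r J.+1 b) (cut_after A k.+1) =
    split_event X1 Rg1 k.+1 k.+1 r (cut_after A k.+1).
  by apply: eq_split_event => // i ik; rewrite /set_bit; case: eqP => //; lia.
rewrite !past [X in _ = _ * X](@split_event_bit _ _ _ _ _ Pr2)// ge0_muleDr// subSn//.
have future b : split_event X2 Rg2 (K - k.+1) (J - k.+1).+1
      (fun l => set_bit r J.+1 b (k.+1 + l)%N) (fun l => A (k.+1 + l)%N) =
    split_event X2 Rg2 (K - k.+1) (J - k.+1).+1
      (set_bit (fun l => r (k.+1 + l)%N) (J - k.+1).+1 b) (fun l => A (k.+1 + l)%N).
  apply: eq_split_event => // i _; rewrite /set_bit.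
  rewrite (_ : (k.+1 + i == J.+1)%N = (i == (J - k.+1).+1)%N)//.
  by apply/eqP/eqP; lia.
by rewrite !future.
Qed.

Lemma first_hit_split_event (k K : nat) (r : nat -> bool) (A : nat -> set S) :
  r k.+1 -> (forall i, (0 < i <= k)%N -> ~~ r i) ->
  split_event X1 Rg1 K k.+1 r A =
  [set w | first_hit (fun i => Rg1 i.+1 w) k /\
           forall i, (i < K.+1)%N -> A i.+1 (X1 i.+1 w)].
Proof.
move=> rk ri; apply/seteqP; split => w /=.
  move=> [h1 h2]; split => //; apply/first_hitP; split; first by rewrite h2.
  by move=> i ik; rewrite h2 ?ri//; lia.
move=> [/first_hitP[h2 h3] h1]; split => // i; rewrite ltnS leq_eqVlt => /orP[/eqP->|ik].
  by rewrite h2 rk.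
by rewrite (negbTE (h3 _ ik)) (negbTE (ri _ _)).
Qed.

Lemma split_chain_regenerates (n : nat) :
  regenerates n Pr1 (fun i => X1 i.+1) (fun i => Rg1 i.+1) Pr2 (fun i => X2 i.+1).
Proof.
apply: regenerates_of_boxes => // k A0 kn mA0.
(* The chain is indexed from 1, hence the shift; [setT] frees the state at time [n + 1] that
   [split_event] also mentions. *)
pose A l := if (0 < l <= n)%N then A0 l.-1 else setT.
have mA i : measurable (A i) by rewrite /A; case: ifP.
pose r l := l == k.+1.
have rk : r k.+1 by rewrite /r.
have ri i : (0 < i <= k)%N -> ~~ r i by rewrite /r => ik; apply/eqP; lia.
transitivity (Pr1 (split_event X1 Rg1 n k.+1 r A)).
  rewrite first_hit_split_event//; congr (Pr1 _); apply/seteqP; split => w /= [hk h]; split => // i ik.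
    by rewrite /A; case: ifP => // /andP[_ /h].
  by have := h i (ltnW ik); rewrite /A ik.
rewrite (@split_event_regeneration k)//; congr (_ * _).
  rewrite first_hit_split_event//; congr (Pr1 _); apply/seteqP; split => w /= [hk h]; split => // i ik.
    by have := h i (ltnW ik); rewrite /cut_after ik /A (leq_trans ik kn).
  rewrite /cut_after; case: ifP => // ik'; rewrite /A; case: ifP => // _; exact: h.
congr (Pr2 _); apply/seteqP; split => w /=.
  move=> [h _] i ik; have := h i (ltnW ik).
  by rewrite addnS /A (_ : 0 < _ <= n)%N//=; lia.
move=> h; split => i; last by rewrite subnn.
by move=> ik; rewrite addnS /A; case: ifP => // ?; apply: h; lia.
Qed.
End two_chains.

(** The event puts the first regeneration at time [k + 1], so the new chain begins with the state at
    time [k + 2]. The past factor is the probability of that event and cancels against the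
    normalisation; what remains is the law started from [nu]. *)
Lemma fresh_split_chain {dO} {O : measurableType dO} (Pr : probability O R)
    (xi : probability S R) (X : nat -> O -> S) (Rg : nat -> O -> bool) (k : nat)
    (mD : measurable [set w | first_hit (fun i => Rg i.+1 w) k]) :
  is_split_chain Pr P xi delta C nu X Rg ->
  0 < Pr [set w | first_hit (fun i => Rg i.+1 w) k] ->
  is_split_chain (mnormalize (mrestr Pr mD) Pr) P nu delta C nu
    (fun i => X (k.+1 + i)%N) (fun i => Rg (k.+1 + i)%N).
Proof.
move=> sc D0 K r0 A0 mA0.
set D := [set w | first_hit _ _] in mD D0 *.
have Dfin : Pr D \is a fin_num by exact: fin_num_measure.
apply: etrans (mnormalize_mrestr mD _ D0) _; rewrite -/D.
(* The flags [0, ..., 0, 1] up to time [k + 1] encode [D], with free states; the prescribed pattern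
   is copied after them. *)
pose r l := if (l <= k)%N then false else if l == k.+1 then true else r0 (l - k.+1)%N.
pose A l := if (l <= k.+1)%N then setT else A0 (l - k.+1)%N.
have mA i : measurable (A i) by rewrite /A; case: ifP.
have rk : r k.+1 by rewrite /r ltnn eqxx.
have ri i : (0 < i <= k)%N -> ~~ r i by rewrite /r => /andP[_ ->].
transitivity (Pr (split_event X Rg (k + K.+1) (k + K.+1) r A) * (fine (Pr D))^-1%:E).
  congr (Pr _ * _); apply/seteqP; split => w /=.
    move=> [[h1 h2] /first_hitP[hk hl]]; split => i iK.
      rewrite /A; case: leqP => // ki; have [l il] : exists l, i.+1 = (k.+1 + l.+1)%N.
        by exists (i - k.+1)%N; lia.
      rewrite il addKn; case: l il => [//|l] il; apply: (h2 l.+1 _).2; lia.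
    rewrite /r; case: ifPn => ki; first by rewrite (negbTE (hl _ ki)).
    case: eqP => [[->]//|ne]; have [l il] : exists l, i.+1 = (k.+1 + l.+1)%N.
      by exists (i - k.+1)%N; lia.
    by rewrite il addKn; apply: (h2 l.+1 _).1; lia.
  have AE l : A (k.+1 + l.+1)%N = A0 l.+1.
    by rewrite /A addKn (_ : (k.+1 + l.+1 <= k.+1)%N = false)//; lia.
  have rE l : r (k.+1 + l.+1)%N = r0 l.+1.
    rewrite /r addKn (_ : (k.+1 + l.+1 <= k)%N = false); last by lia.
    by rewrite (_ : (k.+1 + l.+1 == k.+1)%N = false)//; lia.
  move=> [h1 h2]; split.
    split; first by rewrite -AE; apply: (h1 (k + 1)%N); lia.
    move=> [//|i] iK; split; first by rewrite -rE; apply: (h2 (k + i.+1)%N); lia.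
    by rewrite -AE; apply: (h1 (k + i.+2)%N); lia.
  apply/first_hitP; split; first by rewrite h2//; lia.
  by move=> i ik; rewrite h2; [apply: ri|]; lia.
rewrite (split_chain_event _ _ sc)// (split_mass_regeneration minor)//.
have -> : \int[xi]_(x in A 1%N) split_tail P delta C nu r (cut_after A k.+1) k.+1 1 x = Pr D.
  transitivity (Pr (split_event X Rg k.+1 k.+1 r (cut_after A k.+1))).
    by rewrite (split_chain_event _ _ sc)// => i; rewrite /cut_after; case: ifP.
  rewrite first_hit_split_event//; congr (Pr _); apply/seteqP; split => w /=; first by case.
  by move=> hk; split => // i ik; rewrite /cut_after /A; case: (i.+1 <= k.+1)%N.
have -> : A k.+2 = A0 1%N by rewrite /A ltnn subSnn.
rewrite (_ : split_tail _ _ _ _ _ _ _ _ = split_tail P delta C nu r0 A0 K 1).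
  rewrite -{1}(fineK Dfin) muleAC -EFinM divff ?mul1e// gt_eqF// fine_gt0// D0 ltey.
  by apply: contraTneq Dfin => ->.
apply: split_tail_ext => // l l0; last by rewrite /A addKn (_ : (k.+1 + l <= k.+1)%N = false)//; lia.
rewrite /r addKn (_ : (k.+1 + l <= k)%N = false); last by lia.
by rewrite (_ : (k.+1 + l == k.+1)%N = false)//; lia.
Qed.
End split_chain.

Local Close Scope ereal_scope.

(** * Exponential moments of the blocks *)

Lemma stopped_time_le_hit (b : nat -> bool) (m i : nat) :
  b i -> (stopped_time b m <= i.+1)%N.
Proof.
elim: m b i => [|m IH] b i bi //=; case: ifP => // b0.
by case: i bi => [|i] bi; [rewrite bi in b0|exact: (IH (fun i => b i.+1))].
Qed.

Lemma stopped_time_regen_T1 {R : realType} {O : Type} (Rg : nat -> O -> bool) (m : nat) (w : O) :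
  ((stopped_time (fun i => Rg i.+1 w) m)%:R%:E <= regen_T1 (R := R) Rg w)%E.
Proof.
apply: le_ereal_inf_tmp => _ [[|l] [l0 Rl] <-] //; rewrite lee_fin ler_nat.
exact: (@stopped_time_le_hit (fun i => Rg i.+1 w) m l).
Qed.

Lemma stopped_time_regen_T2 {R : realType} {O : Type} (Rg : nat -> O -> bool) (m k : nat) (w : O) :
  first_hit (fun i => Rg i.+1 w) k ->
  ((stopped_time (fun i => Rg (k.+1 + i.+1)%N w) m)%:R%:E <= regen_T2 (R := R) Rg w)%E.
Proof.
move=> hk; apply: le_ereal_inf_tmp => _ [[|l] [l0 [[|p] [p0 Rp np Rpl]]] <-] //.
rewrite lee_fin ler_nat; have hp : first_hit (fun i => Rg i.+1 w) p.
  by apply/first_hitP; split => // i ip; exact: np.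
rewrite (first_hit_inj hp hk) in Rpl.
exact: (@stopped_time_le_hit (fun i => Rg (k.+1 + i.+1)%N w) m l).
Qed.

Lemma regen_T1_ge1 {R : realType} {O : Type} (Rg : nat -> O -> bool) (w : O) :
  (1 <= regen_T1 (R := R) Rg w)%E.
Proof. by apply: le_ereal_inf_tmp => _ [l [l0 _] <-]; rewrite lee_fin ler1n. Qed.

Lemma regen_T2_ge1 {R : realType} {O : Type} (Rg : nat -> O -> bool) (w : O) :
  (1 <= regen_T2 (R := R) Rg w)%E.
Proof. by apply: le_ereal_inf_tmp => _ [l [l0 _] <-]; rewrite lee_fin ler1n. Qed.

Section psi1.
Context {R : realType} {dO : measure_display} {O : measurableType dO}
  (Pr : probability O R).

Import HBNNSimple.

(* [g] need not be measurable: integrals of nonnegative functions are suprema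
   over simple functions. *)
Lemma ge0_le_integral_of_le (f g : O -> \bar R) :
  (forall w, 0 <= f w)%E -> (forall w, f w <= g w)%E ->
  (\int[Pr]_w f w <= \int[Pr]_w g w)%E.
Proof.
move=> f0 fg; have g0 w : (0 <= g w)%E by exact: le_trans (fg w).
rewrite !ge0_integralTE//; apply: ereal_sup_le => _ [h hf <-].
by exists h => // w; exact: le_trans (fg w).
Qed.

Definition psi1_bounded (Y : O -> \bar R) (c : R) : Prop :=
  (\int[Pr]_w (expeR (`|Y w| * (c^-1)%:E) - 1) <= 1)%E.

Lemma psi1_bounded_le (Y : O -> \bar R) (c : R) (g : O -> R) :
  psi1_bounded Y c -> bounded_mfun g -> (forall w, 0 <= g w) ->
  (forall w, (g w)%:E <= expeR (`|Y w| * (c^-1)%:E) - 1)%E ->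
  \int[Pr]_w g w <= 1.
Proof.
move=> Yc bg g0 gY; rewrite -lee_fin /Rintegral fineK; last first.
  by apply: integrable_fin_num => //; exact: bounded_mfun_integrable.
by apply: le_trans _ Yc; apply: ge0_le_integral_of_le => // w; rewrite lee_fin.
Qed.

Lemma expR_le_psi1 (y : \bar R) (c s : R) : 0 < c -> 0 <= s -> (s%:E <= y)%E ->
  ((expR (s / c) - 1)%:E <= expeR (`|y| * (c^-1)%:E) - 1)%E.
Proof.
move=> c0 s0 sy; rewrite EFinB leeB// -[(expR _)%:E]/(expeR (s / c)%:E) lee_expeR.
rewrite EFinM; apply: lee_wpmul2r; first by rewrite lee_fin invr_ge0 ltW.
by rewrite gee0_abs// (le_trans _ sy).
Qed.

(** The infimum need not be attained, so a slack [1 / 2] is allowed. As [Y >= 1], an admissible [c]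
    satisfies [e^(1/c) <= 2], hence [c >= 1]; then [tau > 1 / 2] and the slack costs at most a
    factor [2]. *)
Lemma psi1_norm_bounded (Y : O -> \bar R) (tau : R) :
  (forall w, 1 <= Y w)%E -> (psi1_norm Pr Y <= tau%:E)%E ->
  exists c, [/\ 1 <= c, c <= 2 * tau & psi1_bounded Y c].
Proof.
move=> Y1 Ytau.
have : (psi1_norm Pr Y < (tau + 2^-1)%:E)%E by apply: le_lt_trans Ytau _; rewrite lte_fin; lra.
move=> /ereal_inf_lt[_ [c [c0 Yc] <-]]; rewrite lte_fin => ctau.
have : expR (1 / c) - 1 <= 1.
  rewrite -[leLHS](Expect_cst Pr); apply: (psi1_bounded_le Yc).
  - exact: bounded_mfun_cst.
  - by move=> w; rewrite subr_ge0 -expR0 ler_expR divr_ge0// ltW.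
  - by move=> w; exact: expR_le_psi1.
have := expR_ge1Dx (1 / c) => h1 h2.
have c1 : 1 <= c by rewrite -[leRHS]mul1r -ler_pdivrMr//; lra.
by exists c; split => //; lra.
Qed.

Lemma psi1_bounded_T1 (Rg : nat -> O -> bool) (c c' : R) (m : nat) :
  (forall i, measurable_fun setT (Rg i)) -> 0 < c -> c <= c' ->
  psi1_bounded (regen_T1 Rg) c ->
  \int[Pr]_w expR ((stopped_time (fun i => Rg i.+1 w) m)%:R / c') <= 2.
Proof.
move=> mR c0 cc' Tc.
have be a : bounded_mfun (fun w => expR ((stopped_time (fun i => Rg i.+1 w) m)%:R / a) : R).
  exact: (measurable_stopped_time (b := fun i => Rg i.+1) m (fun k => expR (k%:R / a))).
have bc1 : bounded_mfun (fun _ : O => 1 : R) by exact: bounded_mfun_cst.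
have : \int[Pr]_w (expR ((stopped_time (fun i => Rg i.+1 w) m)%:R / c) - 1) <= 1.
  apply: (psi1_bounded_le Tc); first exact: bounded_mfunB.
    by move=> w; rewrite subr_ge0 -expR0 ler_expR divr_ge0// ltW.
  by move=> w; apply: expR_le_psi1 => //; exact: stopped_time_regen_T1.
rewrite ExpectB// Expect_cst => h; suff : \int[Pr]_w expR ((stopped_time (fun i => Rg i.+1 w) m)%:R / c')
  <= \int[Pr]_w expR ((stopped_time (fun i => Rg i.+1 w) m)%:R / c) by lra.
apply: Expect_le => // w; rewrite ler_expR ler_wpM2l// lef_pV2// posrE//.
exact: lt_le_trans cc'.
Qed.

(** At most one [k] contributes at each point, and there the shifted capped time is at most [T_2];
    so the sum is the mean of a single function below the [psi_1] integrand. *)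
Lemma psi1_bounded_T2 (Rg : nat -> O -> bool) (c c' : R) (m M : nat) :
  (forall i, measurable_fun setT (Rg i)) -> 0 < c -> c <= c' ->
  psi1_bounded (regen_T2 Rg) c ->
  \sum_(k < M) \int[Pr]_w (if first_hit (fun i => Rg i.+1 w) k then
     expR ((stopped_time (fun i => Rg (k.+1 + i.+1)%N w) m)%:R / c') - 1 else 0) <= 1.
Proof.
move=> mR c0 cc' Tc.
pose g (k : nat) w : R := if first_hit (fun i => Rg i.+1 w) k then
     expR ((stopped_time (fun i => Rg (k.+1 + i.+1)%N w) m)%:R / c') - 1 else 0.
have c'0 : 0 < c' by exact: lt_le_trans cc'.
have bg k : bounded_mfun (g k).
  apply: bounded_mfun_if; last exact: bounded_mfun_cst.
    exact: (measurable_first_hit (b := fun i => Rg i.+1)).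
  apply: bounded_mfunB; last exact: bounded_mfun_cst.
  exact: (measurable_stopped_time (b := fun i => Rg (k.+1 + i.+1)%N) m
    (fun k => expR (k%:R / c'))).
have g0 k w : 0 <= g k w.
  by rewrite /g; case: ifP => // _; rewrite subr_ge0 -expR0 ler_expR divr_ge0// ltW.
rewrite -(Expect_sum Pr (index_enum 'I_M) (fun k : 'I_M => bg k)).
apply: (psi1_bounded_le Tc).
- exact: (bounded_mfun_sum _ (fun k : 'I_M => bg k)).
- by move=> w; apply: sumr_ge0.
move=> w; have [[k kM hk]|none] := first_hit_or_none (fun i => Rg i.+1 w) M.
  rewrite (bigD1 (Ordinal kM))//= big1 ?addr0; last first.
    move=> i ik; rewrite /g; case: ifP => // hi; move: ik.
    by rewrite -val_eqE/= (first_hit_inj hi hk) eqxx.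
  rewrite /g hk; apply: (@le_trans _ _
    (expR ((stopped_time (fun i => Rg (k.+1 + i.+1)%N w) m)%:R / c) - 1)%:E).
    by rewrite lee_fin lerD2r ler_expR ler_wpM2l// lef_pV2// posrE.
  by apply: expR_le_psi1 => //; exact: stopped_time_regen_T2.
rewrite big1; last first.
  move=> k _; rewrite /g; case: ifP => // /first_hitP[Rk _].
  by have := none k (ltn_ord k); rewrite Rk.
apply: (le_trans _ (expR_le_psi1 c0 (lexx 0) _)).
  by rewrite mul0r expR0 subrr.
exact: le_trans (regen_T2_ge1 _ _).
Qed.
End psi1.

Lemma Expect_indicator {R : realType} {dO} {O : measurableType dO} (Pr : probability O R)
    (p : O -> bool) : measurable [set w | p w] ->
  \int[Pr]_w (if p w then 1 else 0) = fine (Pr [set w | p w]).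
Proof.
move=> mp; rewrite /Rintegral; congr fine.
transitivity (\int[Pr]_(w in [set w | p w]) cst 1 w)%E.
  rewrite [RHS]integral_mkcond; apply: eq_integral => w _.
  rewrite patchE; case: ifPn => hp; first by rewrite mem_set.
  by rewrite memNset//; exact/negP.
by rewrite integral_cst// mul1e.
Qed.

(** * Choice of the regeneration that carries the fresh chain *)

Section fresh_block.
Context {R : realType} {dO : measure_display} {O : measurableType dO}
  (Pr : probability O R) (Rg : nat -> O -> bool) (c : R).
Hypotheses (mR : forall i, measurable_fun setT (Rg i)) (c0 : 0 < c).

Let hitb (k : nat) (w : O) := first_hit (fun i => Rg i.+1 w) k.
Let block (m k : nat) (w : O) : R :=
  expR ((stopped_time (fun i => Rg (k.+1 + i.+1)%N w) m)%:R / c).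

Lemma measurable_hit_set (k : nat) : measurable [set w | hitb k w].
Proof. exact: (measurable_first_hit_set (b1 := fun i => Rg i.+1)). Qed.

Let bounded_block m k : bounded_mfun (block m k).
Proof.
exact: (measurable_stopped_time (b := fun i => Rg (k.+1 + i.+1)%N) m
  (fun k => expR (k%:R / c))).
Qed.

Let bounded_hit (g : O -> R) k : bounded_mfun g ->
  bounded_mfun (fun w => if hitb k w then g w else 0).
Proof.
move=> bg; apply: bounded_mfun_if => //; last exact: bounded_mfun_cst.
exact: (measurable_first_hit (b := fun i => Rg i.+1)).
Qed.

(* If every regeneration time failed the bound, summing over them would contradict
   the bound on the second block, since the first block is almost surely finite. *)
Lemma exists_good_regeneration (m : nat) :
  (forall M, \int[Pr]_w expR ((stopped_time (fun i => Rg i.+1 w) M)%:R / c) <= 2) ->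
  (forall M : nat, \sum_(k < M) \int[Pr]_w (if hitb k w then block m k w - 1 else 0) <= 1) ->
  exists k, (0 < Pr [set w | hitb k w])%E /\
    \int[Pr]_w (if hitb k w then block m k w - 1 else 0) <=
    2 * fine (Pr [set w | hitb k w]).
Proof.
move=> h1 h2; apply: contrapT => no.
pose p k : R := fine (Pr [set w | hitb k w]).
have p0 k : 0 <= p k by exact: fine_ge0.
have pE k : \int[Pr]_w (if hitb k w then 1 else 0) = p k.
  exact: (Expect_indicator Pr (measurable_hit_set k)).
have b1 k : bounded_mfun (fun w => if hitb k w then 1 else 0 : R).
  by apply: bounded_hit; exact: bounded_mfun_cst.
have bl k : bounded_mfun (fun w => if hitb k w then block m k w - 1 else 0).
  by apply: bounded_hit; apply: bounded_mfunB => //; exact: bounded_mfun_cst.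
have big k : 2 * p k <= \int[Pr]_w (if hitb k w then block m k w - 1 else 0).
  have [pk0|pk] := eqVneq (Pr [set w | hitb k w]) 0%E.
    rewrite /p pk0 mulr0 -[leLHS](Expect_cst Pr); apply: Expect_le => //.
      exact: bounded_mfun_cst.
    move=> w; case: ifP => // _; rewrite subr_ge0 -expR0 ler_expR.
    by rewrite divr_ge0// ltW.
  apply/ltW; rewrite ltNge; apply/negP => h; apply: no; exists k; split => //.
  by rewrite lt0e pk/=.
(* No regeneration up to time [M] has probability at most [2 e^(-M/c) <= 2/9], as [e^8 >= 9]. Hence
   the [p k] sum to at least [7/9], and twice that exceeds the bound [1] of the second block. *)
pose M := Num.bound (8 * c).
have Mc : 8 * c < M%:R.
  by have := archi_boundP (x := 8 * c); rewrite mulr_ge0// ?(ltW c0)// => /(_ isT).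
pose T w := expR ((stopped_time (fun i => Rg i.+1 w) M)%:R / c).
have bT : bounded_mfun T.
  exact: (measurable_stopped_time (b := fun i => Rg i.+1) M (fun k => expR (k%:R / c))).
have cover : 1 <= \sum_(k < M) p k + expR (- (M%:R / c)) * 2.
  apply: (@le_trans _ _ (\int[Pr]_w (\sum_(k < M) (if hitb k w then 1 else 0) +
      expR (- (M%:R / c)) * T w))).
    rewrite -[leLHS](Expect_cst Pr); apply: Expect_le.
    - exact: bounded_mfun_cst.
    - apply: bounded_mfunD; last exact: bounded_mfunZ.
      exact: (bounded_mfun_sum _ (fun k : 'I_M => b1 k)).
    move=> w; have [[k kM hk]|none] := first_hit_or_none (fun i => Rg i.+1 w) M.
      rewrite (bigD1 (Ordinal kM))//= {1}/hitb hk -addrA lerDl addr_ge0//.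
        by apply: sumr_ge0 => i _; case: ifP.
      by rewrite mulr_ge0// expR_ge0.
    rewrite /T stopped_time_nohit// mulrC expRxMexpNx_1 lerDr.
    by apply: sumr_ge0 => i _; case: ifP.
  rewrite ExpectD; [|exact: (bounded_mfun_sum _ (fun k : 'I_M => b1 k))|
    exact: bounded_mfunZ].
  rewrite (Expect_sum _ _ (fun k : 'I_M => b1 k)) ExpectZ//.
  rewrite lerD ?ler_wpM2l ?expR_ge0//; last exact: h1.
  by apply: ler_sum => k _; rewrite pE.
have small : expR (- (M%:R / c)) <= 9^-1.
  rewrite expRN lef_pV2 ?posrE ?expR_gt0//.
  apply: le_trans (expR_ge1Dx _).
  have : 8 <= M%:R / c by rewrite ler_pdivlMr// ltW.
  lra.
have := h2 M; have : \sum_(k < M) 2 * p k <=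
    \sum_(k < M) \int[Pr]_w (if hitb k w then block m k w - 1 else 0).
  by apply: ler_sum => k _; exact: big.
rewrite -mulr_sumr; lra.
Qed.

(** Under the conditional law the mean of [block - 1] is at most [2], which gives [3]. *)
Lemma good_regeneration_block (m k : nat) (mD : measurable [set w | hitb k w]) :
  (0 < Pr [set w | hitb k w])%E ->
  \int[Pr]_w (if hitb k w then block m k w - 1 else 0) <=
    2 * fine (Pr [set w | hitb k w]) ->
  \int[mnormalize (mrestr Pr mD) Pr]_w block m k w <= 3.
Proof.
set D := [set w | hitb k w] in mD * => D0 h.
have Dfin : Pr D \is a fin_num by exact: fin_num_measure.
have p0 : 0 < fine (Pr D) by rewrite fine_gt0// D0 ltey; apply: contraTneq Dfin => ->.
have bD : \int[Pr]_w (if hitb k w then block m k w else 0) <= 3 * fine (Pr D).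
  have bb := bounded_hit k (bounded_block m k).
  have b1 : bounded_mfun (fun w => if hitb k w then 1 else 0 : R).
    by apply: bounded_hit; exact: bounded_mfun_cst.
  have : \int[Pr]_w ((if hitb k w then block m k w else 0) - (if hitb k w then 1 else 0))
      <= 2 * fine (Pr D).
    apply: le_trans h; apply: Expect_le.
    - exact: bounded_mfunB.
    - by apply: bounded_hit; apply: bounded_mfunB => //; exact: bounded_mfun_cst.
    by move=> w; case: ifP => // _; rewrite subr0.
  rewrite ExpectB// (Expect_indicator Pr mD) -/D; lra.
have q0 : 0 <= (fine (Pr D))^-1 by rewrite invr_ge0 ltW.
pose q : {nonneg R} := NngNum q0.
have mblock : measurable_fun setT (EFin \o block m k).
  by apply/measurable_EFinP; case: (bounded_block m k).
have -> : \int[mnormalize (mrestr Pr mD) Pr]_w block m k w =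
    (fine (Pr D))^-1 * \int[Pr]_w (if hitb k w then block m k w else 0).
  rewrite -ExpectZ; last exact: bounded_hit.
  rewrite /Rintegral; congr fine.
  transitivity (\int[mscale q (mrestr Pr mD)]_w (block m k w)%:E)%E.
    apply: eq_measure_integral => A mA _.
    by apply: etrans (mnormalize_mrestr mD _ D0) _; rewrite muleC.
  rewrite ge0_integral_mscale//; last by move=> w _; rewrite lee_fin expR_ge0.
  rewrite integral_mrestr// integral_mkcond.
  rewrite -ge0_integralZl_EFin//; first last.
  - by apply/(measurable_restrictT _ _).1 => //; exact: measurable_funTS.
  - by move=> w _; apply: erestrict_ge0 => ? _; rewrite lee_fin expR_ge0.
  apply: eq_integral => w _; rewrite patchE; case: (boolP (hitb k w)) => hk.
    by rewrite mem_set.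
  by rewrite memNset ?mulr0 ?mule0//; exact/negP.
by rewrite mulrC ler_pdivrMr.
Qed.
End fresh_block.

(** * Concentration *)

Lemma chernoff {R : realType} {dO} {O : measurableType dO} (Pr : probability O R)
    (g : O -> R) (lam s t : R) :
  bounded_mfun g -> 0 <= lam ->
  \int[Pr]_w expR (lam * g w) <= expR (lam * \int[Pr]_w g w + s) ->
  (Pr [set w | t <= g w - \int[Pr]_w' g w']%R <= (expR (s - lam * t))%:E)%E.
Proof.
move=> bg lam0 h; set m := \int[Pr]_w g w in h *.
have mA : measurable [set w | t <= g w - m].
  rewrite -[X in measurable X]setTI.
  have mle : measurable_fun setT (fun w => t <= g w - m).
    apply: measurable_fun_ler => //; apply: measurable_funB => //.
    by case: bg.
  by have := mle measurableT [set true] Logic.I.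
rewrite -[leLHS]fineK; last exact: fin_num_measure.
rewrite lee_fin -(Expect_indicator Pr mA).
have be : bounded_mfun (fun w => expR (lam * g w)).
  by apply: bounded_mfun_expR; exact: bounded_mfunZ.
apply: (@le_trans _ _ (\int[Pr]_w (expR (- (lam * m) - lam * t) * expR (lam * g w)))).
  apply: Expect_le; last 1 first.
  - move=> w; case: ifP => [tg|_]; last by rewrite mulr_ge0// expR_ge0.
    rewrite -expRD -expR0 ler_expR.
    by have := ler_wpM2l lam0 tg; rewrite mulrBr; lra.
  - apply: bounded_mfun_if; [|exact: bounded_mfun_cst..].
    apply: measurable_fun_ler => //; apply: measurable_funB => //.
    by case: bg.
  - exact: bounded_mfunZ.
rewrite ExpectZ//; apply: le_trans (ler_wpM2l (expR_ge0 _) h) _.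
by rewrite -expRD ler_expR; lra.
Qed.

Section concentration.
Context {R : realType} {d d1 d2 : measure_display} {S : measurableType d}
  {O1 : measurableType d1} {O2 : measurableType d2}
  (Pr1 : probability O1 R) (X1 : nat -> O1 -> S) (b1 : nat -> O1 -> bool)
  (Pr2 : probability O2 R) (X2 : nat -> O2 -> S) (b2 : nat -> O2 -> bool)
  (n : nat) (c : R).
Hypotheses (mX1 : forall i, measurable_fun setT (X1 i))
  (mb1 : forall i, measurable_fun setT (b1 i))
  (mX2 : forall i, measurable_fun setT (X2 i))
  (mb2 : forall i, measurable_fun setT (b2 i))
  (reg1 : regenerates n Pr1 X1 b1 Pr2 X2) (reg2 : regenerates n Pr2 X2 b2 Pr2 X2)
  (c1 : 1 <= c)
  (psi1 : \int[Pr1]_w expR ((stopped_time (b1^~ w) n)%:R / c) <= 3)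
  (psi2 : \int[Pr2]_w expR ((stopped_time (b2^~ w) n)%:R / c) <= 3).

Lemma upper_deviation (f : n.-tuple S -> R) (L t : R) :
  measurable_fun setT f ->
  (forall (s : 'S_n) (u : n.-tuple S), f [tuple tnth u (s i) | i < n] = f u) ->
  (forall u v : n.-tuple S, `|f u - f v| <= L * (hamming u v)%:R) ->
  (0 < n)%N -> 0 < L -> 0 <= t -> t <= L * n%:R ->
  (Pr1 [set w | t <= f (prefix_tuple n (X1^~ w)) -
        \int[Pr1]_w' f (prefix_tuple n (X1^~ w'))]%R <=
   (expR (- (t ^+ 2 / (96 * n%:R * L ^+ 2 * c ^+ 2))))%:E)%E.
Proof.
move=> mf fsym fL n0 L0 t0 tn.
have n0R : 0 < n%:R :> R by rewrite ltr0n.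
have c0 : 0 < c by exact: lt_le_trans c1.
(* The minimiser of [24 n (lam L c)^2 - lam t]; the minimum is [- t^2 / (96 n L^2 c^2)]. *)
pose lam := t / (48 * n%:R * L ^+ 2 * c ^+ 2).
have den0 : 0 < 48 * n%:R * L ^+ 2 * c ^+ 2.
  by rewrite !mulr_gt0// exprn_gt0.
have lam0 : 0 <= lam by rewrite divr_ge0// ltW.
(* From [t <= L n] one gets [lam L <= 1 / (48 c^2)], and [c >= 1] does the rest. *)
have lamL : lam * L <= (2 * c)^-1.
  rewrite /lam -mulrAC ler_pdivrMr//.
  have -> : (2 * c)^-1 * (48 * n%:R * L ^+ 2 * c ^+ 2) = 24 * c * (L * n%:R * L).
    by field; rewrite lt0r_neq0.
  have h1 : t * L <= L * n%:R * L by rewrite ler_wpM2r// ltW.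
  have h2 : 0 <= L * n%:R * L by rewrite !mulr_ge0// ltW.
  have c24 : 0 <= 24 * c - 1 by have := c1; lra.
  have h3 : 0 <= (24 * c - 1) * (L * n%:R * L) by exact: mulr_ge0.
  by lra.
have bf := bounded_mfun_lipschitz mf (ltW L0) fL.
have bg : bounded_mfun (fun w => f (prefix_tuple n (X1^~ w))).
  by apply: bounded_mfun_comp => //; exact: measurable_prefix_tuple.
have lap := laplace_chain mX2 mf (ltW L0) fsym fL c0 lam0 lamL mX1 mb1 mb2 reg1 reg2
  psi1 psi2 n0.
apply: le_trans (chernoff t bg lam0 lap) _; rewrite lee_fin ler_expR.
rewrite le_eqVlt; apply/orP; left; apply/eqP; rewrite /lam.
by field; rewrite !lt0r_neq0.
Qed.

Lemma two_sided_deviation (f : n.-tuple S -> R) (L t : R) :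
  measurable_fun setT f ->
  (forall (s : 'S_n) (u : n.-tuple S), f [tuple tnth u (s i) | i < n] = f u) ->
  (forall u v : n.-tuple S, `|f u - f v| <= L * (hamming u v)%:R) ->
  (0 < n)%N -> 0 < L -> 0 <= t -> t <= L * n%:R ->
  (Pr1 [set w | t <= `|f (prefix_tuple n (X1^~ w)) -
        \int[Pr1]_w' f (prefix_tuple n (X1^~ w'))|]%R <=
   (2 * expR (- (t ^+ 2 / (96 * n%:R * L ^+ 2 * c ^+ 2))))%:E)%E.
Proof.
move=> mf fsym fL n0 L0 t0 tn.
have bf := bounded_mfun_lipschitz mf (ltW L0) fL.
have bg : bounded_mfun (fun w => f (prefix_tuple n (X1^~ w))).
  by apply: bounded_mfun_comp => //; exact: measurable_prefix_tuple.
set m := \int[Pr1]_w' f (prefix_tuple n (X1^~ w')).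
have up := upper_deviation mf fsym fL n0 L0 t0 tn.
have mNf : measurable_fun setT (fun u => - f u) by exact: measurableT_comp.
have Nsym (s : 'S_n) (u : n.-tuple S) : - f [tuple tnth u (s i) | i < n] = - f u.
  by rewrite fsym.
have NL u v : `|- f u - - f v| <= L * (hamming u v)%:R.
  by rewrite -opprD normrN fL.
have := upper_deviation mNf Nsym NL n0 L0 t0 tn.
have -> : \int[Pr1]_w' (- f (prefix_tuple n (X1^~ w'))) = - m.
  under eq_Rintegral do rewrite -mulN1r.
  by rewrite ExpectZ// mulN1r.
rewrite -/m in up * => down; rewrite mulr_natl mulr2n EFinD.
have mle (h : O1 -> R) : measurable_fun setT h -> measurable [set w | t <= h w].
  move=> mh; rewrite -[X in measurable X]setTI.
  have mb : measurable_fun setT (fun w => t <= h w) by exact: measurable_fun_ler.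
  by have := mb measurableT [set true] Logic.I.
have mg := bg.1.
have mup : measurable [set w | t <= f (prefix_tuple n (X1^~ w)) - m].
  by apply: mle; exact: measurable_funB.
have mdn : measurable [set w | t <= - f (prefix_tuple n (X1^~ w)) - - m].
  by apply: mle; apply: measurable_funB => //; exact: measurableT_comp.
apply: le_trans (leeD up down).
apply: le_trans (measureU2 _ mup mdn); apply: le_measure.
- rewrite inE; apply: mle; apply: measurableT_comp => //.
  exact: measurable_funB.
- by rewrite inE; exact: measurableU.
move=> w /=; case: (ger0P (f (prefix_tuple n (X1^~ w)) - m)) => _; first by left.
by move=> h; right; lra.
Qed.
End concentration.

Theorem mainTheorem10 :
  exists K : nat, (0 < K)%N /\
  forall (R : realType) (d : measure_display) (S : measurableType d)
    (dO : measure_display) (O : measurableType dO) (Pr : probability O R)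
    (P : R.-pker S ~> S) (xi : probability S R)
    (delta : R) (C : set S) (nu : probability S R)
    (X : nat -> O -> S) (Rg : nat -> O -> bool) (tau : R)
    (n : nat) (f : n.-tuple S -> R) (L : R),
  minorization P delta C nu ->
  (exists pi : probability S R, stationary P pi) ->
  (forall i, measurable_fun setT (X i)) ->
  (forall i, measurable_fun setT (Rg i)) ->
  is_split_chain Pr P xi delta C nu X Rg ->
  (psi1_norm Pr (regen_T1 Rg) <= tau%:E)%E ->
  (psi1_norm Pr (regen_T2 Rg) <= tau%:E)%E ->
  measurable_fun setT f ->
  (forall (s : 'S_n) (x : n.-tuple S), f [tuple tnth x (s i) | i < n] = f x) ->
  (forall x y : n.-tuple S, `|f x - f y| <= L * (hamming x y)%:R) ->
  forall t : R, 0 <= t ->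
  (Pr [set w | (t%:E <= `| (f [tuple X i.+1 w | i < n])%:E
                  - \int[Pr]_w' (f [tuple X i.+1 w' | i < n])%:E |)%E]
   <= (2 * expR (- (K%:R^-1 * (t ^+ 2 / (n%:R * L ^+ 2 * tau ^+ 2)))))%:E)%E.
Proof.
(* [384 = 96 * 2^2]: the constant of [two_sided_deviation] and the square of the factor in
   [c <= 2 * tau]. *)
exists 384%N; split => // R d S dO O Pr P xi delta C nu X Rg tau n f L.
move=> minor _ mX mR sc T1tau T2tau mf fsym fL t t0.
have trivial_bound (B : R) : 1 <= B -> forall A : set O, measurable A -> (Pr A <= B%:E)%E.
  by move=> B1 A mA; apply: le_trans (probability_le1 _ mA) _; rewrite lee_fin.
pose F w := f (prefix_tuple n (fun i => X i.+1 w)).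
have fL' u v : `|f u - f v| <= `|L| * (hamming u v)%:R.
  by apply: le_trans (fL u v) _; rewrite ler_wpM2r// ler_norm.
have bf := bounded_mfun_lipschitz mf (normr_ge0 L) fL'.
have bF : bounded_mfun F.
  by apply: bounded_mfun_comp => //; exact: measurable_prefix_tuple.
set m := \int[Pr]_w F w.
have -> : (\int[Pr]_w' (f [tuple X i.+1 w' | i < n])%:E)%E = m%:E.
  rewrite /m /Rintegral fineK//; apply: integrable_fin_num => //.
  exact: bounded_mfun_integrable.
set E := [set w | _].
have EE : E = [set w | t <= `|F w - m|] by apply/seteqP; split => w.
have mE : measurable E.
  rewrite EE -[X in measurable X]setTI.
  have mb : measurable_fun setT (fun w => t <= `|F w - m|).
    apply: measurable_fun_ler => //; apply: measurableT_comp => //.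
    by apply: measurable_funB => //; case: bF.
  by have := mb measurableT [set true] Logic.I.
have [t00|tpos] := eqVneq t 0.
  apply: trivial_bound => //.
  by rewrite t00 expr0n mul0r mulr0 oppr0 expR0; lra.
have {tpos} t1 : 0 < t by rewrite lt0r tpos.
(* For [n = 0] the denominator vanishes; since the inverse of [0] is [0], the bound reads [2]. *)
have [n0|npos] := posnP n.
  apply: trivial_bound => //.
  by rewrite n0 !mul0r invr0 !mulr0 oppr0 expR0; lra.
have osc (B : R) : (forall u v, `|f u - f v| <= B) -> forall w, `|F w - m| <= B.
  move=> fB w; rewrite distrC; apply: Expect_norm_sub_le => // w'.
  exact: fB.
have empty (B : R) : (forall u v, `|f u - f v| <= B) -> B < t -> E = set0.
  move=> fB Bt; rewrite EE; apply/seteqP; split => // w /= tF.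
  by have := le_lt_trans (le_trans tF (osc B fB w)) Bt; rewrite ltxx.
have bound0 : 0 <= 2 * expR
    (- (384%:R^-1 * (t ^+ 2 / (n%:R * L ^+ 2 * tau ^+ 2)))).
  by rewrite mulr_ge0// expR_ge0.
have [L0|L0] := leP L 0.
  rewrite (empty 0)// ?measure0 ?lee_fin// => u v.
  by apply: le_trans (fL u v) _; rewrite mulr_le0_ge0.
have [tn|tn] := leP t (L * n%:R); last first.
  rewrite (empty (L * n%:R))// ?measure0 ?lee_fin// => u v.
  exact: (lipschitz_oscillation (ltW L0)).
have [c1 [c11 c1tau T1c]] := psi1_norm_bounded (regen_T1_ge1 Rg) T1tau.
have [c2 [c21 c2tau T2c]] := psi1_norm_bounded (regen_T2_ge1 Rg) T2tau.
pose c := Num.max c1 c2.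
have c1c : c1 <= c by rewrite le_max lexx.
have c2c : c2 <= c by rewrite le_max lexx orbT.
have cge1 : 1 <= c by exact: le_trans c1c.
have ctau : c <= 2 * tau by rewrite ge_max c1tau.
have c0 : 0 < c by exact: lt_le_trans cge1.
have h1 M := psi1_bounded_T1 (Pr := Pr) M mR (lt_le_trans ltr01 c11) c1c T1c.
have h2 M := psi1_bounded_T2 (Pr := Pr) n M mR (lt_le_trans ltr01 c21) c2c T2c.
have [k [Dk0 blk]] := exists_good_regeneration mR c0 h1 h2.
have mD := measurable_hit_set mR k.
have psi2 := good_regeneration_block mR mD Dk0 blk.
have sc2 := fresh_split_chain minor mD sc Dk0.
have mX2 i : measurable_fun setT (X (k.+1 + i)%N) by [].
have mR2 i : measurable_fun setT (Rg (k.+1 + i)%N) by [].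
have reg1 := split_chain_regenerates (n := n) minor mX mR mX2 mR2 sc sc2.
have reg2 := split_chain_regenerates (n := n) minor mX2 mR2 mX2 mR2 sc2 sc2.
have psi1 : \int[Pr]_w expR ((stopped_time (fun i => Rg i.+1 w) n)%:R / c) <= 3.
  by apply: le_trans (h1 n) _; lra.
rewrite EE; apply: le_trans (two_sided_deviation (fun i => mX i.+1) (fun i => mR i.+1)
  (fun i => mX2 i.+1) (fun i => mR2 i.+1) reg1 reg2 cge1 psi1 psi2 mf fsym fL npos L0 t0 tn) _.
rewrite lee_fin ler_wpM2l// ler_expR lerN2.
have n0R : 0 < n%:R :> R by rewrite ltr0n.
have tau0 : 0 < tau by lra.
have -> : 384%:R^-1 * (t ^+ 2 / (n%:R * L ^+ 2 * tau ^+ 2)) =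
    t ^+ 2 / (96 * n%:R * L ^+ 2 * (2 * tau) ^+ 2).
  by field; rewrite !lt0r_neq0.
apply: ler_wpM2l; first exact: sqr_ge0.
have A0 : 0 < 96 * n%:R * L ^+ 2 :> R by rewrite !mulr_gt0// exprn_gt0.
rewrite lef_pV2 ?posrE; last 2 first.
- by rewrite mulr_gt0// exprn_gt0// mulr_gt0.
- by rewrite mulr_gt0// exprn_gt0.
by rewrite ler_pM2l// lerXn2r// nnegrE; lra.
Qed.
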